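(* Let $t_0 \in \{0, 4, 5\}$ and let $t \ge 1$ be an integer. If $t_0 \in\{4,5\}$ let $s = -1$; if $t_0 = 0$ let $s \in \{-1,1\}$. Put $T = t_0 + 9t$, let $M$ be the square-free part of $T^2 - 4s$, and $E_s(T) = \frac12(T + \sqrt{T^2 - 4s})$, a unit of norm $s$ of $\mathbb{Q}(\sqrt M)$. Then the class number of the imaginary quadratic field $\mathbb{Q}(\sqrt{-3M})$ is divisible by $3$, unless $E_s(T) \in \langle \varepsilon_M^3 \rangle$. Moreover, let $M$ be the square-free part of $81 t^2 - 1$ with $t \ge 1$, $t \equiv 2$ or $5 \pmod 7$, or the square-free part of $81 t^2 + 1$ with $t \ge 1$, $t \equiv 3$ or $4 \pmod 7$. Then the class number of $\mathbb{Q}(\sqrt{-3M})$ is divisible by $3$.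
   Context: For a square-free integer $M \ge 2$, $\varepsilon_M > 1$ is the fundamental unit of $\mathbb{Q}(\sqrt M)$. The square-free part of a nonzero integer $n$ is the unique square-free $M$ with $n = M r^2$, $r\ge1$. *)

(* Defs.v *)
From mathcomp Require Import all_boot all_order all_algebra all_field.
Set Implicit Arguments. Unset Strict Implicit. Unset Printing Implicit Defensive.
Import Order.TTheory GRing.Theory Num.Theory.
Local Open Scope ring_scope.

(* x is an algebraic integer of Q(sqrt n) (n a non-square integer):
   x = a + b sqrt n with a, b rational, trace 2a and norm a^2 - n b^2 in Z. *)
Definition qint (n : int) (x : algC) : Prop :=
  exists a b : rat, x = ratr a + ratr b * sqrtC (n%:~R) /\
    (exists z : int, 2 * a = z%:~R) /\
    (exists z : int, a ^+ 2 - n%:~R * b ^+ 2 = z%:~R).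

Definition qunit (n : int) (u : algC) : Prop :=
  qint n u /\ u != 0 /\ qint n u^-1.

Definition fund_unit (n : int) (e : algC) : Prop :=
  qunit n e /\ 1 < e /\ forall u, qunit n u -> 1 < u -> e <= u.

Definition qideal (n : int) (I : algC -> Prop) : Prop :=
  (forall x, I x -> qint n x) /\ I 0 /\ (exists x, I x /\ x != 0) /\
  (forall x y, I x -> I y -> I (x + y)) /\
  (forall r x, qint n r -> I x -> I (r * x)).

Definition ideal_equiv (n : int) (I J : algC -> Prop) : Prop :=
  exists a b : algC, qint n a /\ a != 0 /\ qint n b /\ b != 0 /\
    forall x, (exists y, I y /\ x = a * y) <-> (exists y, J y /\ x = b * y).

Definition has_class_number (n : int) (h : nat) : Prop :=
  exists reps : seq (algC -> Prop), size reps = h /\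
    (forall i, (i < h)%N -> qideal n (nth (fun _ => False) reps i)) /\
    forall J, qideal n J ->
      exists! i, (i < h)%N /\ ideal_equiv n J (nth (fun _ => False) reps i).

Definition sqfree_int (m : int) : Prop :=
  m != 0 /\ forall p : nat, prime p -> ~~ (p ^ 2 %| `|m|)%N.

Definition sqfree_part (n m : int) : Prop :=
  sqfree_int m /\ exists r : nat, (0 < r)%N /\ n = m * (r%:Z) ^+ 2.

Definition E_s (s T : int) : algC := (T%:~R + sqrtC ((T ^+ 2 - 4 * s)%:~R)) / 2.

(* Main.v *)
Require Import Defs.
From HB Require Import structures.
From mathcomp Require Import all_boot all_order all_algebra all_fingroup all_solvable all_field.
From mathcomp Require Import boolp.
From mathcomp Require Import ring lra zify.
Set Implicit Arguments. Unset Strict Implicit. Unset Printing Implicit Defensive.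
Import Order.TTheory GRing.Theory Num.Theory.
Local Open Scope ring_scope.

(* Let K = Q(sqrt(-3M)), let u be the real cube root of E_s(T) and t0 = u + s/u, a root of
   X^3 - 3sX - T. If t0 is a rational integer, then u is a unit of Q(sqrt M), so E_s(T) is the
   cube of a power of the fundamental unit. Otherwise N = K(t0) is a cyclic cubic extension of
   K, with group generated by sg, and it is unramified: this is where the class of T modulo 9
   enters. One then argues as in Hilbert's Theorem 94. If every unit of N of relative norm 1
   were of the form e / sg e, it would be a 3^k-th power of such a unit for every k, which is
   absurd for a unit of absolute value > 1; such a unit exists by Dirichlet's pigeonhole
   argument. So let eta be a unit of norm 1 not of that form, and write eta = al / sg al by
   Hilbert 90. The ideal (al) is invariant under sg, hence, N/K being unramified, it is
   generated by an ideal a of K. The cube of a is generated by the norm of al, but a is not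
   principal, so multiplication by a permutes the ideal classes of K in orbits of length 3. *)

(** Unramifiedness is never stated; what is used is that [al] lies in [a O_N]. For [p] in [O_N],
    Lagrange interpolation at the conjugates of [p] shows that [al], times the derivative at [p] of
    the characteristic polynomial of [p] over K, lies in [a O_N]. Adding this up over the conjugates
    of [p] turns the factor into the integer [e1^2 - 3 e2], with [e1], [e2] the first two symmetric
    functions of the conjugates. Two elements with coprime such integers suffice: [t0] settles every
    prime but 3, and the congruence on T modulo 9 supplies a second element for 3. It also supplies
    an element of trace 1, by which statements about N descend to K. The units of K need control as
    well: K differs from Q(sqrt(-3)) because [T^2 - 4 s] is not a square, so its units satisfy
    [v^4 = 1], which allows correcting a unit of N to one of relative norm 1. In the second
    assertion T is [18 t], and the condition modulo 7 excludes that [t0] is an integer. *)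

Lemma fixed_by_aut_Crat (x : algC) :
  (forall nu : {rmorphism algC -> algC}, nu x = x) -> x \in Crat.
Proof.
move=> fix_x.
have [p [Dp mon_p] dv_p] := minCpolyP x.
have [rs Drs] := closed_field_poly_normal (minCpoly x).
rewrite (monicP (minCpoly_monic x)) scale1r in Drs.
(* The splitting field of the minimal polynomial is Galois over the rationals and its automorphisms
   extend to algC, so [x] is fixed by its whole Galois group. *)
have [Q0 [QC [rs1 Drs1 genQ]]] := num_field_exists rs.
pose pQ : {poly Q0} := map_poly (in_alg Q0) p.
have pQP : pQ = \prod_(z <- rs1) ('X - z%:P).
  apply: (map_poly_inj QC); rewrite -map_poly_comp.
  rewrite (@eq_map_poly _ _ _ ratr); last first.
    by move=> a; rewrite /= rmorphZ_num rmorph1 mulr1.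
  rewrite -Dp Drs -Drs1 big_map rmorph_prod; apply: eq_bigr => z _.
  by rewrite /= map_polyXsubC.
have splQ : splittingFieldFor 1 pQ {:Q0} by exists rs1 => //; rewrite pQP eqpxx.
have pQ1 : pQ \is a polyOver 1%VS.
  by apply/polyOver1P; exists p.
have axQ : SplittingField.axiom Q0 by exists pQ.
pose QMixin := FieldExt_isSplittingField.Build _ Q0 axQ.
pose Q : splittingFieldType rat := HB.pack Q0 QMixin.
have galQ : galois 1 {:Q}.
  apply/and3P; split; first exact: sub1v.
    apply/separableP => y _; apply: pcharf0_separable => q.
    by rewrite pchar_lalg pchar_num.
  apply/splitting_normalField; first exact: sub1v.
  by exists pQ.
have /mapP[y _ Dx] : x \in map QC rs1.
  by rewrite Drs1 -root_prod_XsubC -Drs root_minCpoly.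
have : (y : Q) \in fixedField 'Gal({:Q} / 1)%g.
  apply/fixedFieldP; first exact: memvf.
  move=> g _.
  have [nu Dnu] := extend_algC_subfield_aut QC (g : {rmorphism Q -> Q}).
  by apply: (fmorph_inj QC); rewrite Dnu -Dx fix_x.
rewrite (galois_fixedField galQ) => /vlineP[a Da].
by rewrite Dx Da alg_num_field fmorph_rat Crat_rat.
Qed.

(** * Quadratic fields inside the algebraic numbers *)

(** This covers quadratic equations too: a root of a monic quadratic is a root of X times it, the
    case [c = 0]. *)
Lemma Aint_cubic (a b c : int) (x : algC) :
  x ^+ 3 - a%:~R * x ^+ 2 + b%:~R * x - c%:~R = 0 -> x \in Aint.
Proof.
move=> x0; pose s : seq algC := [:: - c%:~R; b%:~R; - a%:~R; 1].
have sE : Poly s = s :> seq algC by exact: (@PolyK _ 0 s (oner_neq0 _)).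
apply: (@root_monic_Aint (Poly s)).
- by rewrite rootE horner_Poly /=; apply/eqP; rewrite -[RHS]x0; ring.
- by rewrite monicE lead_coefE sE.
- apply/polyOverP => i; rewrite sE.
  case: i => [|[|[|[|i]]]] /=.
  - by rewrite rpredN intr_int.
  - exact: intr_int.
  - by rewrite rpredN intr_int.
  - exact: rpred1.
  - by rewrite nth_nil rpred0.
Qed.

Lemma Crat_Aint_intr (x : algC) : x \in Crat -> x \in Aint -> exists z : int, x = z%:~R.
Proof. by move=> Qx Ax; apply/intrP/Cint_rat_Aint. Qed.

Lemma conjCD (x y : algC) : (x + y)^* = x^* + y^*. Proof. exact: rmorphD. Qed.

Lemma conjCM (x y : algC) : (x * y)^* = x^* * y^*. Proof. exact: rmorphM. Qed.

Definition quad (n : int) (x : algC) : Prop :=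
  exists a b : rat, x = ratr a + ratr b * sqrtC (n%:~R).

Lemma quadM (n : int) (x y : algC) : quad n x -> quad n y -> quad n (x * y).
Proof.
move=> [a [b ->]] [a' [b' ->]]; set w := sqrtC _.
have w2 : w ^+ 2 = n%:~R by exact: sqrtCK.
exists (a * a' + n%:~R * (b * b')), (a * b' + b * a').
rewrite (rmorphD ratr (a * a')) (rmorphD ratr (a * b')) /= (rmorphM ratr a a').
rewrite (rmorphM ratr a b') (rmorphM ratr b a') (rmorphM ratr n%:~R) (rmorphM ratr b b') /=.
by rewrite ratr_int -/w -w2; ring.
Qed.

Lemma quad_Aint (n : int) (x : algC) : qint n x -> quad n x /\ x \in Aint.
Proof.
move=> [a [b [Dx [[t Dt] [d Dd]]]]]; split; first by exists a, b.
have tC : 2 * ratr a = t%:~R :> algC.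
  by rewrite -(ratr_int algC t) -Dt (rmorphM ratr 2) /= ratr_nat.
have dC : ratr a ^+ 2 - n%:~R * ratr b ^+ 2 = d%:~R :> algC.
  by rewrite -(ratr_int algC d) -Dd rmorphB /= (rmorphM ratr n%:~R) /= !(rmorphXn ratr) /= ratr_int.
have w2 : sqrtC (n%:~R : algC) ^+ 2 = n%:~R by exact: sqrtCK.
set w := sqrtC _ in w2 Dx.
by apply: (@Aint_cubic t d 0); rewrite Dx -tC -dC -w2; ring.
Qed.

(** The trace [x + c x] and the norm [x * c x] are rational and integral. Complex conjugation serves
    as [c] when [n < 0]; for a real quadratic field another automorphism has to be supplied. *)
Lemma Aint_qint (n : int) (c : {rmorphism algC -> algC}) (x : algC) :
  c (sqrtC n%:~R) = - sqrtC n%:~R -> quad n x -> x \in Aint -> qint n x.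
Proof.
set w := sqrtC _ => cw [a [b]]; rewrite -/w => Dx Ax.
have w2 : w ^+ 2 = n%:~R by exact: sqrtCK.
have cx : c x = ratr a - ratr b * w.
  by rewrite Dx rmorphD (rmorphM c (ratr b)) !fmorph_rat -/w cw mulrN.
have Acx : c x \in Aint by rewrite Aint_aut.
have xx : x + c x = ratr (2 * a).
  rewrite cx Dx (rmorphM ratr 2) /= ratr_nat; ring.
have nx : x * c x = ratr (a ^+ 2 - n%:~R * b ^+ 2).
  rewrite cx Dx rmorphB /= (rmorphM ratr n%:~R) /= !(rmorphXn ratr) /= ratr_int -w2; ring.
exists a, b; split=> //; split.
- have [|z Dz] := Crat_Aint_intr (Crat_rat (2 * a)); first by rewrite -xx rpredD.
  by exists z; apply: (fmorph_inj (ratr : rat -> algC)); rewrite /= Dz ratr_int.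
- have [|z Dz] := Crat_Aint_intr (Crat_rat (a ^+ 2 - n%:~R * b ^+ 2)); first by rewrite -nx rpredM.
  by exists z; apply: (fmorph_inj (ratr : rat -> algC)); rewrite /= Dz ratr_int.
Qed.

Section ImaginaryQuadratic.

Variable n : int.
Hypothesis n_lt0 : n < 0.
Let w : algC := sqrtC (n%:~R).

Lemma sqr_w : w ^+ 2 = n%:~R. Proof. exact: sqrtCK. Qed.

Lemma w_neq0 : w != 0.
Proof. by rewrite sqrtC_eq0 intr_eq0 lt_eqF. Qed.

Lemma conj_w : w^* = - w.
Proof.
have /eqP : w^* ^+ 2 = w ^+ 2 by rewrite -rmorphXn /= sqr_w rmorph_int.
rewrite eqf_sqr => /orP[|] /eqP // wR.
have: 0 <= w ^+ 2 by rewrite real_exprn_even_ge0 //; apply/CrealP.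
by rewrite sqr_w ler0z leNgt n_lt0.
Qed.

Lemma conj_ratrDw (a b : rat) : (ratr a + ratr b * w)^* = ratr a - ratr b * w.
Proof.
by rewrite conjCD (conjCM (ratr b)) conj_w !(conj_Crat (Crat_rat _)) mulrN.
Qed.

Lemma quad_fixed (nu : {rmorphism algC -> algC}) (x : algC) :
  nu w = w -> quad n x -> nu x = x.
Proof.
by move=> nuw [a [b ->]]; rewrite rmorphD (rmorphM nu (ratr b)) !fmorph_rat -/w nuw.
Qed.

(* Complex conjugation moves [sqrt n], so [x + Num.conj x] and
   [(x - Num.conj x) * sqrt n] are fixed by every automorphism of algC. *)
Lemma fixed_quad (x : algC) :
  (forall nu : {rmorphism algC -> algC}, nu w = w -> nu x = x) -> quad n x.
Proof.
move=> fix_x.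
have sgn_w (nu : {rmorphism algC -> algC}) : nu w = w \/ nu w = - w.
  have /eqP : nu w ^+ 2 = w ^+ 2 by rewrite -rmorphXn /= sqr_w rmorph_int.
  by rewrite eqf_sqr => /orP[] /eqP; [left | right].
pose c : {rmorphism algC -> algC} := Num.conj.
have cw : c w = - w by exact: conj_w.
have cK y : c (c y) = y by exact: conjCK.
have act (nu : {rmorphism algC -> algC}) :
  (nu w = w /\ nu x = x /\ nu (c x) = c x) \/
  (nu w = - w /\ nu x = c x /\ nu (c x) = x).
  have [nuw|nuw] := sgn_w nu; [left | right]; split => //; split.
  - exact: fix_x.
  - have := fix_x (c \o nu \o c : {rmorphism algC -> algC}).
    by rewrite /= cw rmorphN nuw rmorphN cw opprK => /(_ erefl) {2}<-; rewrite cK.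
  - have := fix_x (c \o nu : {rmorphism algC -> algC}).
    by rewrite /= nuw rmorphN cw opprK => /(_ erefl) {2}<-; rewrite cK.
  - have := fix_x (nu \o c : {rmorphism algC -> algC}).
    by rewrite /= cw rmorphN nuw opprK => /(_ erefl).
have /CratP[a Da] : x + c x \in Crat.
  apply: fixed_by_aut_Crat => nu; rewrite rmorphD.
  by have [[_ [-> ->]]|[_ [-> ->]]] := act nu; rewrite // addrC.
have /CratP[b Db] : (x - c x) * w \in Crat.
  apply: fixed_by_aut_Crat => nu; rewrite rmorphM rmorphB.
  by have [[-> [-> ->]]|[-> [-> ->]]] := act nu; rewrite // mulrN -mulNr opprB.
have Ea : ratr (a / 2) = ratr a / 2 :> algC.
  by rewrite (fmorph_div ratr a) /= ratr_nat.
have Eb : ratr (b / (2 * n%:~R)) = ratr b / (2 * n%:~R) :> algC.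
  by rewrite (fmorph_div ratr b) /= (rmorphM ratr 2) /= ratr_nat ratr_int.
exists (a / 2), (b / (2 * n%:~R)); rewrite -/w Ea Eb -Da -Db -sqr_w.
by field; exact: w_neq0.
Qed.

(** With this Galois description, closure under the field operations only expresses that
    automorphisms are ring morphisms. *)
Lemma quadP (x : algC) :
  quad n x <-> (forall nu : {rmorphism algC -> algC}, nu w = w -> nu x = x).
Proof. by split=> [qx nu nuw|]; [exact: quad_fixed | exact: fixed_quad]. Qed.

Lemma quadD x y : quad n x -> quad n y -> quad n (x + y).
Proof.
by rewrite !quadP => hx hy nu nuw; rewrite rmorphD hx ?hy.
Qed.

Lemma quadV x : quad n x -> quad n x^-1.
Proof. by rewrite !quadP => hx nu nuw; rewrite fmorphV hx. Qed.

Lemma quadN x : quad n x -> quad n (- x).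
Proof. by rewrite !quadP => hx nu nuw; rewrite rmorphN hx. Qed.

Lemma quad_ratr a : quad n (ratr a).
Proof. by rewrite quadP => nu nuw; rewrite fmorph_rat. Qed.

Lemma quad_int (z : int) : quad n z%:~R.
Proof. by rewrite -(ratr_int algC); exact: quad_ratr. Qed.

Lemma quad_w : quad n w.
Proof. by rewrite quadP. Qed.

Lemma quad_conj x : quad n x -> quad n x^*.
Proof.
move=> [a [b ->]]; exists a, (- b).
by rewrite -/w conj_ratrDw rmorphN mulNr.
Qed.

Lemma qintP x : qint n x <-> quad n x /\ x \in Aint.
Proof.
split; first exact: quad_Aint.
by move=> [qx Ax]; apply: (Aint_qint (c := Num.conj)) => //; exact: conj_w.
Qed.

Lemma qintD x y : qint n x -> qint n y -> qint n (x + y).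
Proof.
by rewrite !qintP => -[? ?] [? ?]; split; [exact: quadD | rewrite rpredD].
Qed.

Lemma qintM x y : qint n x -> qint n y -> qint n (x * y).
Proof.
by rewrite !qintP => -[? ?] [? ?]; split; [exact: quadM | rewrite rpredM].
Qed.

Lemma qintN x : qint n x -> qint n (- x).
Proof.
by rewrite !qintP => -[? ?]; split; [exact: quadN | rewrite rpredN].
Qed.

Lemma qint_int (z : int) : qint n z%:~R.
Proof. by rewrite qintP; split; [exact: quad_int | exact: Aint_int]. Qed.

Lemma qint_nat (z : nat) : qint n z%:R.
Proof. exact: (qint_int z). Qed.

Lemma qint_w : qint n w.
Proof.
rewrite qintP; split; first exact: quad_w.
by apply: (@Aint_cubic 0 (- n) 0); rewrite rmorphN /= -sqr_w; ring.
Qed.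

Lemma qint_conj x : qint n x -> qint n x^*.
Proof.
by rewrite !qintP => -[? ?]; split; [exact: quad_conj | rewrite (Aint_aut Num.conj)].
Qed.

Lemma quad_real_Crat x : quad n x -> x^* = x -> x \in Crat.
Proof.
move=> [a [b Ex]] xR; have E : x + x = ratr (2 * a).
  by rewrite -{2}xR Ex -/w conj_ratrDw (rmorphM ratr 2) /= ratr_nat; ring.
have -> : x = (x + x) / 2 by field.
by apply: rpred_div; [rewrite E; exact: Crat_rat | exact: rpred_nat].
Qed.

Lemma quad_norm_rat x : quad n x -> x * x^* \in Crat.
Proof.
move=> [a [b ->]].
rewrite -/w conj_ratrDw.
have -> : (ratr a + ratr b * w) * (ratr a - ratr b * w) = ratr a ^+ 2 - ratr b ^+ 2 * n%:~R.
  by rewrite -sqr_w; ring.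
apply: rpredB; first by apply: rpredX; exact: Crat_rat.
by apply: rpredM; [apply: rpredX; exact: Crat_rat | exact: rpred_int].
Qed.

Lemma qint_normP x : qint n x -> exists k : nat, x * x^* = k%:R.
Proof.
move=> qx; have [Kx Ax] := (qintP x).1 qx.
have [z Dz] := Crat_Aint_intr (quad_norm_rat Kx) (rpredM Ax (((qintP _).1 (qint_conj qx)).2)).
have z0 : 0 <= z by rewrite -(ler0z algC) -Dz mul_conjC_ge0.
by exists `|z|%N; rewrite Dz natr_absz ger0_norm.
Qed.

End ImaginaryQuadratic.

(** * Ideal classes of imaginary quadratic fields *)

(** The factors may come from different rings: with [B := ON] below, this is the extension of an
    ideal of K to the integers of N. *)
Inductive prodI (A B : algC -> Prop) : algC -> Prop :=
| prodI0 : prodI A B 0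
| prodIS a b x : A a -> B b -> prodI A B x -> prodI A B (a * b + x).

Section ProdI.

Variables A B : algC -> Prop.

Lemma prodI_mul a b : A a -> B b -> prodI A B (a * b).
Proof. by move=> Aa Bb; rewrite -[a * b]addr0; apply: prodIS => //; exact: prodI0. Qed.

Lemma prodI_add x y : prodI A B x -> prodI A B y -> prodI A B (x + y).
Proof.
move=> Px Py; elim: Px => [|a b {}x Aa Bb _ IH]; first by rewrite add0r.
by rewrite -addrA; apply: prodIS.
Qed.

Lemma prodI_scale c x : (forall a, A a -> A (c * a)) -> prodI A B x -> prodI A B (c * x).
Proof.
move=> Ac; elim=> [|a b {}x Aa Bb _ IH]; first by rewrite mulr0; exact: prodI0.
by rewrite mulrDr mulrA; apply: prodIS => //; exact: Ac.
Qed.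

Lemma prodI_sub (C : algC -> Prop) : C 0 -> (forall x y, C x -> C y -> C (x + y)) ->
  (forall a b, A a -> B b -> C (a * b)) -> forall x, prodI A B x -> C x.
Proof.
by move=> C0 CD CM x; elim=> [//|a b {}x Aa Bb _ IH]; apply: CD => //; exact: CM.
Qed.

End ProdI.

(** * Pigeonhole principle and simultaneous rational approximation *)

Definition cell (R : archiRealFieldType) (m : nat) (y : R) : 'I_m.+1 := inord (Num.truncn (m.+1%:R * y)).

Lemma cell_close (R : archiRealFieldType) (m : nat) (y z : R) :
  0 <= y < 1 -> 0 <= z < 1 -> cell m y = cell m z -> m.+1%:R * `|y - z| < 1.
Proof.
move=> /andP[y0 y1] /andP[z0 z1].
have m0 : (0 : R) < m.+1%:R by rewrite ltr0Sn.
have ub (t : R) : 0 <= t -> t < 1 -> (Num.truncn (m.+1%:R * t) < m.+1)%N.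
  by move=> t0 t1; rewrite (truncn_lt_nat _ (mulr_ge0 (ltW m0) t0)) gtr_pMr.
move=> /(congr1 val); rewrite /= !inordK ?ub // => E.
have := truncn_itv (mulr_ge0 (ltW m0) y0); have := truncn_itv (mulr_ge0 (ltW m0) z0).
rewrite E => /andP[h1 h2] /andP[h3 h4].
rewrite -[m.+1%:R]gtr0_norm // -normrM mulrBr ltr_norml.
move: h1 h2 h3 h4; rewrite -[_.+1%:R]natr1; set u := _%:R; set v := m.+1%:R * z; set v' := m.+1%:R * y.
lra.
Qed.

Lemma pigeonhole (S T : finType) (f : S -> T) :
  (#|T| < #|S|)%N -> exists x y, x != y /\ f x = f y.
Proof.
move=> ltTS; apply: contrapT => nex.
have inj : injective f.
  by move=> x y fxy; apply: contrapT => /eqP nxy; apply: nex; exists x, y.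
by move: ltTS; rewrite ltnNge (leq_card f inj).
Qed.

(** The [(m+1)^2 + 1] first multiples of the pair, reduced modulo 1, fall into [(m+1)^2] boxes; [k]
    is the difference of two indices sharing a box. *)
Lemma dirichlet_approx2 (a b : rat) (m : nat) : exists (k : nat) (p q : int),
  [/\ (0 < k)%N, (k <= m.+1 ^ 2)%N, m.+1%:R * `|k%:R * a - p%:~R| < 1
    & m.+1%:R * `|k%:R * b - q%:~R| < 1].
Proof.
pose fr (x : rat) := x - (Num.floor x)%:~R.
have fr01 x : 0 <= fr x < 1.
  rewrite /fr subr_ge0 ltrBlDl Num.Theory.floor_le /=.
  by have := Num.Theory.floorD1_gt x; rewrite intrD addrC.
pose f (k : 'I_(m.+1 ^ 2).+1) := (cell m (fr (k%:R * a)), cell m (fr (k%:R * b))).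
have [|i [j [nij [ea eb]]]] := @pigeonhole _ _ f _.
  by rewrite card_prod !card_ord mulnn.
wlog ltij : i j nij ea eb / (i < j)%N.
  move=> W; have [lij|lij|/ord_inj E] := ltngtP i j; first exact: (W i j).
    by apply: (W j i) => //; rewrite eq_sym.
  by rewrite E eqxx in nij.
exists (j - i)%N, (Num.floor (j%:R * a) - Num.floor (i%:R * a)),
  (Num.floor (j%:R * b) - Num.floor (i%:R * b)).
have E x : (j - i)%:R * x - (Num.floor (j%:R * x) - Num.floor (i%:R * x))%:~R = fr (j%:R * x) - fr (i%:R * x).
  by rewrite natrB ?(ltnW ltij) // /fr intrB; ring.
split; first by rewrite subn_gt0.
- by have := ltn_ord j; rewrite ltnS => /(leq_trans (leq_subr _ _)).
- by rewrite E; apply: cell_close.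
- by rewrite E; apply: cell_close.
Qed.

Section Ideals.

Variable n : int.

Lemma qideal_qint J x : qideal n J -> J x -> qint n x.
Proof. by move=> [h _]; exact: h. Qed.

Lemma qideal0 J : qideal n J -> J 0.
Proof. by move=> [_ []]. Qed.

Lemma qidealD J x y : qideal n J -> J x -> J y -> J (x + y).
Proof. by move=> [_ [_ [_ [h _]]]]; exact: h. Qed.

Lemma qidealM J r x : qideal n J -> qint n r -> J x -> J (r * x).
Proof. by move=> [_ [_ [_ [_ h]]]]; exact: h. Qed.

Lemma ideal_equiv_sym I J : ideal_equiv n I J -> ideal_equiv n J I.
Proof.
move=> [a [b [qa [a0 [qb [b0 E]]]]]]; exists b, a.
split=> //; split=> //; split=> //; split=> // x.
by case: (E x) => h1 h2; split=> [/h2|/h1].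
Qed.

End Ideals.

(** * Bounded denominators: every ideal class contains an ideal dividing a fixed integer *)

Section Finiteness.

Variable n : int.
Hypothesis n_lt0 : n < 0.
Let w : algC := sqrtC (n%:~R).

Lemma ideal_equiv_trans I J K :
  ideal_equiv n I J -> ideal_equiv n J K -> ideal_equiv n I K.
Proof.
move=> [a [b [qa [a0 [qb [b0 E]]]]]] [c [d [qc [c0 [qd [d0 F]]]]]].
exists (a * c), (b * d); rewrite !mulf_neq0 //; 
split; first exact: qintM.
split=> //; split; first exact: qintM.
split=> // x; split=> [[y [Iy ->]]|[y [Ky ->]]].
- have [z [Jz Ez]] : exists z, J z /\ a * y = b * z by apply/E; exists y.
  have [t [Kt Et]] : exists t, K t /\ c * z = d * t by apply/F; exists z.
  by exists t; split=> //; rewrite (mulrC a) -(mulrA c a) Ez mulrCA Et mulrA.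
- have [z [Jz Ez]] : exists z, J z /\ d * y = c * z by apply/F; exists y.
  have [t [It Et]] : exists t, I t /\ b * z = a * t by apply/E; exists z.
  by exists t; split=> //; rewrite -(mulrA b d) Ez mulrCA Et; ring.
Qed.

Definition approx_bound : nat := (`|n|.+1 ^ 2)%N.

(** A substitute for Euclidean division. Both coordinates are approximated within [1/(|n|+1)], so
    the error has norm less than [(1+|n|)/(|n|+1)^2], which is at most 1; this dictates
    [approx_bound]. *)
Lemma quad_approx x : quad n x -> exists (k : nat) (g : algC),
  [/\ (0 < k)%N, (k <= approx_bound)%N, qint n g & `|k%:R * x - g| < 1].
Proof.
move=> [a [b ->]]; have [k [p [q [k0 kB ha hb]]]] := dirichlet_approx2 a b `|n|.
exists k, (p%:~R + q%:~R * w); split=> //.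
  apply: qintD => //; first exact: qint_int.
  by apply: qintM; [|exact: qint_int|exact: qint_w].
set a' := k%:R * a - p%:~R in ha; set b' := k%:R * b - q%:~R in hb.
have -> : k%:R * (ratr a + ratr b * sqrtC n%:~R) - (p%:~R + q%:~R * w)
  = ratr a' + ratr b' * w :> algC.
  rewrite /a' /b' !rmorphB !(rmorphM ratr k%:R) /= !ratr_nat !ratr_int /w; ring.
clearbody a' b'; rewrite -(expr_lt1 (n := 2)) // normCK (conj_ratrDw n_lt0).
have -> : (ratr a' + ratr b' * w) * (ratr a' - ratr b' * w) = ratr (a' ^+ 2 - n%:~R * b' ^+ 2).
  rewrite rmorphB /= (rmorphM ratr n%:~R) /= !(rmorphXn ratr) /= ratr_int -(sqr_w n).
  by rewrite -/w; ring.
have -> : (1 : algC) = ratr 1 by rewrite rmorph1.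
rewrite ltr_rat.
have nE : n%:~R = - `|n|%N%:R :> rat by rewrite natr_absz ltr0_norm // rmorphN opprK.
have sq (t : rat) : `|n|.+1%:R * `|t| < 1 -> `|n|.+1%:R ^+ 2 * t ^+ 2 < 1 :> rat.
  by move=> ht; rewrite -(real_normK (num_real t)) -exprMn expr_lt1 // mulr_ge0.
move: (sq _ ha) (sq _ hb); rewrite nE -natr1; move: (ler0n rat `|n|%N).
set v : rat := `|n|%N%:R; set s := a' ^+ 2; set t := b' ^+ 2 => v0 hs ht.
have v1 : 0 < (v + 1) ^+ 2 by rewrite exprn_gt0 // ltr_wpDl.
rewrite -(ltr_pM2l v1) mulr1 mulNr opprK mulrDr.
have: v * ((v + 1) ^+ 2 * t) <= v * 1 by rewrite ler_wpM2l // ltW.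
have : (v + 1) <= (v + 1) ^+ 2 by rewrite expr2 ler_peMr // ?lerDr // addr_ge0.
rewrite (mulrCA _ v t); set X := _ * t; set Y := _ * s in hs *; lra.
Qed.

Lemma ideal_min J : qideal n J ->
  exists b, [/\ J b, b != 0 & forall y, J y -> `|y| < `|b| -> y = 0].
Proof.
move=> idJ; have [_ [_ [[x0 [Jx0 x00]] _]]] := idJ.
pose P k := `[< exists x, [/\ J x, x != 0 & x * x^* = k%:R] >].
have exP : exists k, P k.
  by have [k Ek] := qint_normP n_lt0 (qideal_qint idJ Jx0); exists k; apply/asboolP; exists x0.
have [k /asboolP[b [Jb b0 Eb]] min_k] := ex_minnP exP.
exists b; split=> // y Jy lt_yb; apply/eqP/negPn/negP => y0.
have [l El] := qint_normP n_lt0 (qideal_qint idJ Jy).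
have : (k <= l)%N by apply: min_k; apply/asboolP; exists y.
rewrite leqNgt -(ltr_nat algC) -El -Eb -!normCK.
by rewrite ltr_pXn2r ?nnegrE ?lt_yb.
Qed.

(** [J'] is [(D/b) J], with [b] a shortest nonzero element of [J]. For [y] in [J], some [k y] with
    [k] at most [approx_bound] is closer than [|b|] to a multiple [g b], hence equal to it, so
    [D y / b] is integral; and [D] lies in [J'] because [b] lies in [J]. *)
Lemma ideal_contract J : qideal n J ->
  exists J', [/\ qideal n J', J' (approx_bound`!)%:R & ideal_equiv n J J'].
Proof.
move=> idJ; have [b [Jb b0 min_b]] := ideal_min idJ.
set D := approx_bound`!; have D0 : D%:R != 0 :> algC by rewrite pnatr_eq0 -lt0n fact_gt0.
have qb := qideal_qint idJ Jb.
exists (fun x => exists y, J y /\ b * x = D%:R * y); split; first split.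
- move=> x [y [Jy Ex]].
  have qyb : quad n (y / b).
    apply: quadM => //; first by case/(qintP n_lt0): (qideal_qint idJ Jy).
    by apply: quadV => //; case/(qintP n_lt0): qb.
  have [k [g [k0 kB qg lt1]]] := quad_approx qyb.
  have Eky : k%:R * y - g * b = 0.
    apply: min_b.
      apply: (qidealD idJ); first by apply: (qidealM idJ) => //; exact: qint_nat.
      by rewrite -mulNr; apply: (qidealM idJ) => //; exact: qintN.
    have -> : k%:R * y - g * b = (k%:R * (y / b) - g) * b by field.
    by rewrite normrM gtr_pMl ?normr_gt0.
  have /dvdnP[q Dq] : (k %| D)%N by rewrite dvdn_fact // k0.
  have -> : x = q%:R * g.
    apply: (mulfI b0); rewrite Ex Dq natrM -mulrA.
    by move/eqP: Eky; rewrite subr_eq0 => /eqP ->; ring.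
  by apply: qintM => //; exact: qint_nat.
- split; first by exists 0; rewrite !mulr0; split=> //; exact: qideal0 idJ.
  split; first by exists D%:R; split=> //; exists b; rewrite mulrC.
  split=> [x y [x' [Jx' Ex]] [y' [Jy' Ey]]|r x qr [x' [Jx' Ex]]].
    by exists (x' + y'); split; [exact: (qidealD idJ) | rewrite !mulrDr Ex Ey].
  by exists (r * x'); split; [exact: (qidealM idJ) | rewrite mulrCA Ex mulrCA].
- by exists b; split=> //; rewrite mulrC.
- exists D%:R, b; split; first exact: qint_nat.
  split=> //; split=> //; split=> // x; split=> [[y [Jy ->]]|[y [[z [Jz Ez]] ->]]].
    exists (D%:R * y / b); split; last by field.
    by exists y; split=> //; field.
  by exists z; rewrite Ez.
Qed.

(** Here [n] may have square factors, so the denominator of [b] need not divide 2; but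
    [(2 n b)^2 = n (t^2 - 4 d)] is an integer, with [t] the trace and [d] the norm. *)
Lemma qint_coords x : qint n x -> exists p q : int,
  2 * n%:~R * x = p%:~R + q%:~R * w.
Proof.
move=> [a [b [-> [[t Et] [d Ed]]]]].
have [q Eq] : exists q : int, 2 * n%:~R * b = q%:~R :> rat.
  have Eb2 : (2 * n%:~R * b) ^+ 2 = (n * (t ^+ 2 - 4 * d))%:~R :> rat.
    rewrite rmorphM rmorphB rmorphXn /= rmorphM /= -Et -Ed; ring.
  have : ratr (2 * n%:~R * b) \in Aint.
    have E2C : ratr (2 * n%:~R * b) ^+ 2 = (n * (t ^+ 2 - 4 * d))%:~R :> algC.
      by rewrite -(ratr_int algC) -Eb2 (rmorphXn ratr).
    by apply: (@Aint_cubic 0 (- (n * (t ^+ 2 - 4 * d))) 0); rewrite rmorphN /= -E2C; ring.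
  move=> /(Crat_Aint_intr (Crat_rat _))[q Eq]; exists q.
  by apply: (fmorph_inj (ratr : rat -> algC)); rewrite /= Eq ratr_int.
have EqC : 2 * n%:~R * ratr b = q%:~R :> algC.
  by rewrite -(ratr_int algC q) -Eq (rmorphM ratr (2 * _)) /= (rmorphM ratr 2) /= ratr_nat ratr_int.
have EtC : 2 * ratr a = t%:~R :> algC.
  by rewrite -(ratr_int algC t) -Et (rmorphM ratr 2) /= ratr_nat.
exists (n * t), q; rewrite rmorphM /= -EqC -EtC -/w; ring.
Qed.

End Finiteness.

Lemma ordinal_modz (N : nat) (p : int) : (0 < N)%N ->
  exists (p0 : 'I_N) (i : int), p = p0%:Z + i * N%:Z.
Proof.
move=> N0; have NZ0 : N%:Z != 0 by rewrite eqz_nat -lt0n.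
have m0 := modz_ge0 p NZ0.
have ltN : (`|(p %% N%:Z)%Z| < N)%N.
  by rewrite -ltz_nat gez0_abs // ltz_pmod // ltz_nat.
exists (Ordinal ltN), (p %/ N%:Z)%Z; rewrite /= gez0_abs // addrC; exact: divz_eq.
Qed.

(** * Finiteness of the class number and representatives of the classes *)

Section ClassNumber.

Variable n : int.
Hypothesis n_lt0 : n < 0.
Let w : algC := sqrtC (n%:~R).

Definition covers (h : nat) : Prop :=
  exists r : 'I_h -> (algC -> Prop), (forall i, qideal n (r i)) /\
    forall J, qideal n J -> exists i, ideal_equiv n J (r i).

Lemma qideal_qint_self : qideal n (qint n).
Proof.
split=> //; split; first exact: (qint_int n_lt0 0).
split; first by exists 1; split; [exact: (qint_int n_lt0 1) | exact: oner_neq0].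
by split=> *; [exact: qintD | exact: qintM].
Qed.

Section Residues.

Variable D : nat.
Hypothesis D_gt0 : (0 < D)%N.
Let N := (2 * `|n| * D)%N.

(** Since [N / (2 n) = - D], changing the coordinates of [qint_coords] by multiples of [N] adds a
    multiple of [D]. An ideal containing [D] is thus determined by this set, and there are finitely
    many such sets. *)
Definition resid (I : algC -> Prop) : {set 'I_N * 'I_N} :=
  [set pq : 'I_N * 'I_N | `[< I ((pq.1%:R + pq.2%:R * w) / (2 * n%:~R)) >]].

Lemma resid_sub I I' : qideal n I -> qideal n I' -> I D%:R -> I' D%:R ->
  resid I = resid I' -> forall x, I x -> I' x.
Proof.
move=> idI idI' ID I'D E x Ix.
have N0 : (0 < N)%N by rewrite !muln_gt0 D_gt0 absz_gt0 lt_eqF.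
have [p [q Epq]] := qint_coords (qideal_qint idI Ix).
have [p0 [i Ep]] := ordinal_modz p N0; have [q0 [j Eq]] := ordinal_modz q N0.
have n0 : n%:~R != 0 :> algC by rewrite intr_eq0 lt_eqF.
have NE : N%:~R = - (2 * n%:~R * D%:R) :> algC.
  have -> : n%:~R = - `|n|%N%:R :> algC by rewrite natr_absz ltr0_norm // rmorphN opprK.
  by rewrite /N -pmulrn !natrM; ring.
have q_ij : qint n (i%:~R + j%:~R * w).
  by apply: qintD => //; [|apply: qintM => //; [|exact: qint_w]]; exact: qint_int.
have Ex : x = (p0%:R + q0%:R * w) / (2 * n%:~R) - (i%:~R + j%:~R * w) * D%:R.
  have -> : x = (p%:~R + q%:~R * w) / (2 * n%:~R) by rewrite -Epq; field.
  by rewrite Ep Eq !intrD !intrM NE -!pmulrn; field.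
have : (p0, q0) \in resid I.
  rewrite inE; apply/asboolP => /=.
  have -> : (p0%:R + q0%:R * w) / (2 * n%:~R) = x + (i%:~R + j%:~R * w) * D%:R.
    by rewrite Ex; ring.
  by apply: (qidealD idI) => //; apply: (qidealM idI).
rewrite E inE => /asboolP /= I'x; rewrite Ex; apply: (qidealD idI') => //.
by rewrite -mulNr; apply: (qidealM idI') => //; exact: qintN.
Qed.

End Residues.

Lemma finite_cover : exists h, covers h.
Proof.
pose D := (approx_bound n)`!; have D0 : (0 < D)%N := fact_gt0 _.
pose T : finType := {set 'I_(2 * `|n| * D) * 'I_(2 * `|n| * D)}.
pose good (S : T) I := [/\ qideal n I, I D%:R & resid D I = S].
(* A set of residues that no ideal realises gets the unit ideal as a dummy. *)
have rep (S : T) : exists I, qideal n I /\ ((exists I', good S I') -> good S I).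
  have [[I gI]|nI] := pselect (exists I', good S I'); first by exists I; split=> //; case: gI.
  by exists (qint n); split=> //; exact: qideal_qint_self.
have [r rP] := choice rep.
exists #|T|, (fun i => r (enum_val i)); split=> [i|J idJ]; first by case: (rP (enum_val i)).
have [J' [idJ' J'D eqJ]] := ideal_contract n_lt0 idJ.
exists (enum_rank (resid D J' : T)); rewrite enum_rankK.
suff -> : r (resid D J') = J' by [].
have [_ /(_ (ex_intro _ J' _))[//|idr rD Er]] := rP (resid D J').
apply/funext => x; apply/propext; split.
- exact: (resid_sub D0).
- by apply: (resid_sub D0); rewrite ?Er.
Qed.

(** In a cover of least size no two members are equivalent, since one of them could be dropped. *)
Lemma min_cover : exists h (r : 'I_h -> (algC -> Prop)),
  [/\ forall i, qideal n (r i),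
      forall J, qideal n J -> exists i, ideal_equiv n J (r i)
    & forall i j, ideal_equiv n (r i) (r j) -> i = j].
Proof.
have exP : exists h, `[< covers h >] by have [h ch] := finite_cover; exists h; apply/asboolP.
have [h /asboolP[r [idr cov]] min_h] := ex_minnP exP.
exists h, r; split=> // i j eij; apply/eqP/negPn/negP => nij.
case: h => [|h] in r idr cov min_h i j eij nij *; first by case: i nij eij.
have : (h.+1 <= h)%N; last by rewrite ltnn.
apply/min_h/asboolP; exists (fun k => r (lift j k)); split=> // J idJ.
have [k ek] := cov J idJ.
have [kj|nkj] := eqVneq k j; last first.
  by rewrite eq_sym in nkj; have [k' Ek' _] := unlift_some nkj; exists k'; rewrite -Ek'.
rewrite eq_sym in nij; have [i' Ei' _] := unlift_some nij.
exists i'; rewrite -Ei'; apply: (ideal_equiv_trans n_lt0 ek).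
by rewrite kj; exact: ideal_equiv_sym.
Qed.

Lemma has_class_number_min h (r : 'I_h -> (algC -> Prop)) :
  (forall i, qideal n (r i)) ->
  (forall J, qideal n J -> exists i, ideal_equiv n J (r i)) ->
  (forall i j, ideal_equiv n (r i) (r j) -> i = j) ->
  has_class_number n h.
Proof.
move=> idr cov inj; exists (codom r); split; first by rewrite size_codom card_ord.
have nthr (i : 'I_h) : nth (fun _ => False) (codom r) i = r i.
  by rewrite codomE (nth_map i) ?size_enum_ord // nth_ord_enum.
split=> [i lti|J idJ]; first by rewrite -[i]/(val (Ordinal lti)) nthr.
have [i ei] := cov J idJ; exists (i : nat); split; first by rewrite nthr; split; first exact: ltn_ord.
move=> j [ltj]; rewrite -[j]/(val (Ordinal ltj)) nthr => ej.
congr nat_of_ord; apply: inj; apply: (ideal_equiv_trans n_lt0 _ ej); exact: ideal_equiv_sym.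
Qed.

End ClassNumber.

(** * Class numbers divisible by 3 *)

Lemma dvdn3_iter3 (T : finType) (f : T -> T) :
  (forall x, f (f (f x)) = x) -> (forall x, f x != x) -> (3 %| #|T|)%N.
Proof.
move=> f3 fnx; have injf : injective f by apply: (can_inj (g := f \o f)) => x /=.
pose p := perm injf.
have p3 : (p ^+ 3 = 1)%g.
  by apply/permP => x; rewrite permX /= !permE.
have gp : (3.-group <[p]>)%g.
  by rewrite /pgroup -orderE (@pnat_dvd _ 3) // order_dvdn p3.
have := pgroup_fix_mod (S := [set: T]) (to := perm_action T) gp.
have -> : ('Fix_([set: T] | 'P)(<[p]>))%g = set0.
  apply/setP => x; rewrite in_set0; apply/negP => /setIP[_ /afixP/(_ p (cycle_id p))].
  by rewrite /= apermE permE => /eqP; apply/negP.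
rewrite cardsT cards0 /dvdn mod0n => -> //.
by apply/actsP => q _ x; rewrite !inE.
Qed.

Section ClassNumber3.

Variable n : int.
Hypothesis n_lt0 : n < 0.

Definition conjI (J : algC -> Prop) : algC -> Prop := fun x => J x^*.

(* Hurwitz: the gcd [g] of the norms of the elements of [J] generates [J] times its
   conjugate, since [x * Num.conj y / g] has integral trace and norm for [x], [y] in [J]. *)
Lemma ideal_norm J : qideal n J -> exists g : nat,
  [/\ (0 < g)%N, prodI J (conjI J) g%:R
    & forall x y, J x -> J y -> exists z, qint n z /\ x * y^* = g%:R * z].
Proof.
move=> idJ; have [_ [_ [[x0 [Jx0 x00]] _]]] := idJ.
pose G (k : int) := prodI J (conjI J) k%:~R.
have Gmul x y : J x -> J y -> prodI J (conjI J) (x * y^*).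
  by move=> Jx Jy; apply: prodI_mul => //; rewrite /conjI conjCK.
have Gscale k l : G l -> G (k * l).
  rewrite /G intrM => Gl; apply: prodI_scale => // a Ja.
  by apply: (qidealM idJ) => //; exact: qint_int.
have exG : exists k, (0 < k)%N && `[< G k%:Z >].
  have [k Ek] := qint_normP n_lt0 (qideal_qint idJ Jx0); exists k; apply/andP; split.
    by rewrite lt0n -(pnatr_eq0 algC) -Ek mul_conjC_eq0.
  by apply/asboolP; rewrite /G -pmulrn -Ek; exact: Gmul.
have [g /andP[g0 /asboolP Gg] min_g] := ex_minnP exG.
have dvdG k : G k -> exists l, k = l * g%:Z.
  move=> Gk; exists (k %/ g%:Z)%Z; rewrite [LHS](divz_eq k g%:Z).
  have gZ0 : g%:Z != 0 by rewrite eqz_nat -lt0n.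
  have r0 := modz_ge0 k gZ0; have rg : (k %% g%:Z)%Z < g%:Z by rewrite ltz_pmod // ltz_nat.
  have Gr : G (k %% g%:Z)%Z.
    have -> : (k %% g%:Z)%Z = k + (- (k %/ g%:Z)%Z) * g%:Z.
      by rewrite {2}(divz_eq k g%:Z); ring.
    by rewrite /G intrD; apply: prodI_add => //; exact: Gscale.
  have [->|rn0] := eqVneq (k %% g%:Z)%Z 0; first by rewrite addr0.
  have : (g <= `|(k %% g%:Z)%Z|)%N.
    by apply: min_g; rewrite absz_gt0 rn0; apply/asboolP; rewrite gez0_abs.
  by rewrite leqNgt -ltz_nat gez0_abs // rg.
have gC0 : g%:R != 0 :> algC by rewrite pnatr_eq0 -lt0n.
exists g; split=> // x y Jx Jy.
have qx := qideal_qint idJ Jx; have qy := qideal_qint idJ Jy.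
have qxy : qint n (x * y^*) by apply: (qintM n_lt0) => //; exact: (qint_conj n_lt0).
have norm_dvd u : J u -> exists l : int, u * u^* = l%:~R * g%:R.
  move=> Ju; have [k Ek] := qint_normP n_lt0 (qideal_qint idJ Ju).
  have [|l El] := dvdG k%:Z; first by rewrite /G -pmulrn -Ek; exact: Gmul.
  by exists l; rewrite Ek pmulrn El intrM.
have [a Ea] := norm_dvd x Jx; have [b Eb] := norm_dvd y Jy.
have [c Ec] := norm_dvd (x + y) (qidealD idJ Jx Jy).
(* Polarization: this trace is the norm of [x + y] minus the norms of [x] and [y]. *)
have Et : x * y^* + x^* * y = (c - a - b)%:~R * g%:R.
  rewrite !intrD !rmorphN /= !mulrDl !mulNr -Ea -Eb -Ec conjCD; ring.
exists (x * y^* / g%:R); split; last by field.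
apply/(qintP n_lt0); split.
  apply: quadM; first by case/(qintP n_lt0): qxy.
  by apply: (quadV n_lt0); exact: (quad_int n_lt0 g).
apply: (@Aint_cubic (c - a - b) (a * b) 0).
have Et' : (c - a - b)%:~R = (x * y^* + x^* * y) / g%:R :> algC by rewrite Et mulfK.
have Eab : (a * b)%:~R = (x * x^*) * (y * y^*) / g%:R ^+ 2 :> algC.
  by rewrite Ea Eb intrM; field.
by rewrite Et' Eab; field.
Qed.

Lemma prodI_equiv a I J p q : (forall y, I y -> exists z, J z /\ p * y = q * z) ->
  forall x, prodI a I x -> exists z, prodI a J z /\ p * x = q * z.
Proof.
move=> h x; elim=> [|b y {}x ab Iy _ [z [Jz Ez]]].
  by exists 0; rewrite !mulr0; split=> //; exact: prodI0.
have [t [Jt Et]] := h _ Iy; exists (b * t + z); split; first exact: prodIS.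
by rewrite !mulrDr mulrCA Et Ez mulrCA.
Qed.

Lemma qideal_prodI a J : qideal n a -> qideal n J -> qideal n (prodI a J).
Proof.
move=> ida idJ; split.
  apply: prodI_sub => [|x y qx qy|x y ax Jy]; first exact: (qint_int n_lt0 0).
    exact: (qintD n_lt0).
  by apply: (qintM n_lt0); [exact: qideal_qint ida _|exact: qideal_qint idJ _].
split; first exact: prodI0.
split; last first.
  split=> [x y|r x qr]; first exact: prodI_add.
  by apply: prodI_scale => b ab; exact: (qidealM ida).
have [_ [_ [[b [ab b0]] _]]] := ida; have [_ [_ [[y [Jy y0]] _]]] := idJ.
by exists (b * y); rewrite mulf_neq0 //; split=> //; exact: prodI_mul.
Qed.

Lemma ideal_equiv_prodI a I J : ideal_equiv n I J -> ideal_equiv n (prodI a I) (prodI a J).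
Proof.
move=> [p [q [qp [p0 [qq [q0 E]]]]]]; exists p, q.
split=> //; split=> //; split=> //; split=> // x; split=> [[y [Py ->]]|[y [Py ->]]].
- apply: (prodI_equiv _ Py) => z Iz; have [|t [? ?]] := (E (p * z)).1; first by exists z.
  by exists t.
- apply: (prodI_equiv _ Py) => z Jz; have [|t [? ?]] := (E (q * z)).2; first by exists z.
  by exists t.
Qed.

(** Cancellation of [J]: from [p a J = q J], multiplying by the conjugate of [J] and using that [J]
    times its conjugate is [(g)] gives [p a = (q)]. Both inclusions run along a decomposition of [g]
    into products. *)
Lemma prodI_equiv_principal a J : qideal n a -> qideal n J -> ideal_equiv n (prodI a J) J ->
  exists c, c != 0 /\ forall x, a x <-> exists z, qint n z /\ x = c * z.
Proof.
move=> ida idJ [p [q [qp [p0 [qq [q0 E]]]]]].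
have [g [g0 Pg divg]] := ideal_norm idJ.
have gC0 : g%:R != 0 :> algC by rewrite pnatr_eq0 -lt0n.
exists (q / p); split; first by rewrite mulf_neq0 // invr_neq0.
move=> x; split=> [ax|[z [qz ->]]].
- have : exists z, qint n z /\ p * x * g%:R = q * (g%:R * z).
    elim: {1}_ / Pg => [|y y' t Jy Jy' _ [z [qz Ez]]].
      by exists 0; rewrite !mulr0; split=> //; exact: (qint_int n_lt0 0).
    have [|j [Jj Ej]] := (E (p * (x * y))).1; first by exists (x * y); split=> //; exact: prodI_mul.
    have [u [qu Eu]] := divg _ _ Jj Jy'; rewrite conjCK in Eu.
    exists (u + z); split; first exact: (qintD n_lt0).
    by rewrite !mulrDr -Eu -Ez mulrA -(mulrA p) Ej mulrA.
  move=> [z [qz Ez]]; exists z; split=> //.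
  by apply: (mulIf gC0); apply: (mulfI p0); rewrite mulrA Ez; field.
- suff : exists b, a b /\ q * z * g%:R = p * g%:R * b.
    move=> [b [ab Eb]]; suff -> : q / p * z = b by [].
    apply: (mulIf gC0); apply: (mulfI p0).
    have -> : p * (b * g%:R) = q * z * g%:R by rewrite Eb; ring.
    by field.
  elim: {1}_ / Pg => [|y y' t Jy Jy' _ [b [ab Eb]]].
    by exists 0; rewrite !mulr0; split=> //; exact: qideal0 ida.
  have [|j [Pj Ej]] := (E (q * (z * y))).2.
    by exists (z * y); split=> //; exact: (qidealM idJ).
  have [c [ac Ec]] : exists c, a c /\ j * y' = g%:R * c.
    elim: Pj {Ej} => [|c d j' ac Jd _ [b' [ab' Eb']]].
      by exists 0; rewrite mul0r mulr0; split=> //; exact: qideal0 ida.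
    have [u [qu Eu]] := divg _ _ Jd Jy'; rewrite conjCK in Eu.
    exists (u * c + b'); split; first by apply: (qidealD ida) => //; exact: (qidealM ida).
    by rewrite mulrDl Eb' -mulrA Eu; ring.
  exists (c + b); split; first exact: (qidealD ida).
  by rewrite !mulrDr -Eb -(mulrA p) -Ec; congr (_ + _); rewrite mulrA -(mulrA q) Ej mulrA.
Qed.

(** That the cube of [a] is [(m)] is stated through its action on every [J], with products nested to
    the right: this is what three applications of the permutation of the representatives produce. *)
Lemma class_number_dvd3 a m : qideal n a -> qint n m -> m != 0 ->
  (forall J, qideal n J -> forall x,
     prodI a (prodI a (prodI a J)) x <-> exists y, J y /\ x = m * y) ->
  ~ (exists c, c != 0 /\ forall x, a x <-> exists z, qint n z /\ x = c * z) ->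
  exists h : nat, has_class_number n h /\ (3 %| h)%N.
Proof.
move=> ida qm m0 a3 nprin.
have [h [r [idr cov inj]]] := min_cover n_lt0.
exists h; split; first exact: (has_class_number_min n_lt0 idr).
have [f fP] := choice (fun i => cov _ (qideal_prodI ida (idr i))).
rewrite -(card_ord h); apply: (@dvdn3_iter3 _ f) => [i|i].
- apply: inj; apply: ideal_equiv_sym.
  apply: (ideal_equiv_trans n_lt0 (J := prodI a (prodI a (prodI a (r i))))).
    exists m, 1; split=> //; split=> //; split; first exact: (qint_int n_lt0 1).
    split; first exact: oner_neq0.
    move=> x; rewrite -(a3 _ (idr i)); split=> [Px|[y [Py ->]]]; last by rewrite mul1r.
    by exists x; rewrite mul1r.
  apply: (ideal_equiv_trans n_lt0 (J := prodI a (prodI a (r (f i))))).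
    by do 2!apply: ideal_equiv_prodI.
  by apply: (ideal_equiv_trans n_lt0 (J := prodI a (r (f (f i))))) => //; exact: ideal_equiv_prodI.
- apply/negP => /eqP Ei; apply: nprin; apply: (prodI_equiv_principal ida (idr i)).
  by rewrite -{2}Ei.
Qed.

End ClassNumber3.

(** * Unramified cyclic cubic extensions *)

(** The [(Q+1)^3] forms with coefficients between 0 and [Q] have absolute value less than [Q M];
    cutting that interval into [Q^3] cells of length [2 M / Q^2] puts two of them into one cell. The
    summand 2 in [M], instead of 1, makes the bound strict. *)
Lemma small_quadratic_form (R : archiRealFieldType) (t : R) (Q : nat) : (0 < Q)%N ->
  exists x y z : int, [/\ (x, y, z) <> (0, 0, 0), [/\ `|x| <= Q%:Z, `|y| <= Q%:Z & `|z| <= Q%:Z]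
    & `|x%:~R + y%:~R * t + z%:~R * t ^+ 2| * Q%:R ^+ 2 < 2 * (2 + `|t| + t ^+ 2)].
Proof.
move=> Q0; set M := 2 + `|t| + t ^+ 2.
have t2 : 0 <= t ^+ 2 := sqr_ge0 t; have t1 := normr_ge0 t.
have QR : 0 < Q%:R :> R by rewrite ltr0n.
have M0 : 0 < M by rewrite /M; lra.
have QM : 0 < Q%:R * M by rewrite mulr_gt0.
pose form (v : 'I_Q.+1 * 'I_Q.+1 * 'I_Q.+1) : R := v.1.1%:R + v.1.2%:R * t + v.2%:R * t ^+ 2.
have form_lt v : `|form v| < Q%:R * M.
  have ub (i : 'I_Q.+1) : i%:R <= Q%:R :> R by rewrite ler_nat -ltnS.
  apply: le_lt_trans (ler_normD _ _) _; apply: (@le_lt_trans _ _ (Q%:R + Q%:R * `|t| + Q%:R * t ^+ 2)).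
    apply: lerD; last by rewrite (normrM _ (t ^+ 2)) normr_nat (ger0_norm t2) ler_wpM2r.
    apply: le_trans (ler_normD _ _) _.
    by rewrite (normrM _ t) !normr_nat lerD // ler_wpM2r.
  by rewrite /M !mulrDr; lra.
pose h v := (form v + Q%:R * M) / (2 * (Q%:R * M)).
have h01 v : 0 <= h v < 1.
  have := form_lt v; rewrite ltr_norml => /andP[l1 l2]; apply/andP; split.
    by apply: divr_ge0; lra.
  by rewrite ltr_pdivrMr; lra.
have [|u [v [nuv Euv]]] := @pigeonhole _ _ (fun v => cell (Q ^ 3).-1 (h v)) _.
  rewrite !card_prod !card_ord prednK ?expn_gt0 ?Q0 //.
  by rewrite !expnS expn0 muln1; nia.
have := cell_close (h01 u) (h01 v) Euv; rewrite prednK ?expn_gt0 ?Q0 // => close.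
exists (u.1.1%:Z - v.1.1%:Z), (u.1.2%:Z - v.1.2%:Z), (u.2%:Z - v.2%:Z); split.
- move=> [E1 E2 E3]; case/eqP: nuv.
  move: u v E1 E2 E3 {Euv close} => [[a b] c] [[a' b'] c'] /=.
  by move=> E1 E2 E3; congr (_, _, _); apply: val_inj => /=; lia.
- have bd (i j : 'I_Q.+1) : `|i%:Z - j%:Z| <= Q%:Z.
    by have := ltn_ord i; have := ltn_ord j; rewrite !ltnS; lia.
  by split; exact: bd.
- have -> : (u.1.1%:Z - v.1.1%:Z)%:~R + (u.1.2%:Z - v.1.2%:Z)%:~R * t + (u.2%:Z - v.2%:Z)%:~R * t ^+ 2
    = form u - form v by rewrite /form !intrB -!pmulrn; ring.
  have E : h u - h v = (form u - form v) / (2 * (Q%:R * M)).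
    by rewrite /h -mulrBl; congr (_ / _); ring.
  move: close; rewrite E normrM [`|_^-1|]gtr0_norm; last by rewrite invr_gt0 mulr_gt0.
  rewrite [_%:R * _]mulrA ltr_pdivrMr; last by rewrite mulr_gt0.
  rewrite mul1r natrX => close; rewrite -(ltr_pM2l QR).
  by apply: le_lt_trans _ (lt_le_trans close _); rewrite le_eqVlt; apply/orP; left; apply/eqP; ring.
Qed.

Lemma bernoulli (r : algC) (j : nat) : 1 <= r -> 1 + j%:R * (r - 1) <= r ^+ j.
Proof.
move=> r1; elim: j => [|j IH]; first by rewrite mul0r addr0 expr0.
have r0 : 0 <= r - 1 by rewrite subr_ge0.
have E : r ^+ j.+1 = r ^+ j + (r - 1) * r ^+ j by rewrite exprS; ring.
rewrite E -natr1 mulrDl mul1r addrA; apply: lerD => //.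
by apply: ler_peMr => //; exact: exprn_ege1.
Qed.

(** * The cyclic cubic extension N/K inside algC *)

Section Cubic.

Variables (n : int) (t0 t1 t2 : algC) (e1 e2 e3 : int).
Hypothesis n_lt0 : n < 0.
Let w : algC := sqrtC (n%:~R).
Let V := (t0 - t1) * (t1 - t2) * (t2 - t0).
Hypothesis sum_t : t0 + t1 + t2 = e1%:~R.
Hypothesis sum2_t : t0 * t1 + t1 * t2 + t2 * t0 = e2%:~R.
Hypothesis prod_t : t0 * t1 * t2 = e3%:~R.
Hypothesis quad_V : quad n V.
Hypothesis V_neq0 : V != 0.

Lemma aut_root (nu : {rmorphism algC -> algC}) (x : algC) :
  (x - t0) * (x - t1) * (x - t2) = 0 -> [\/ nu x = t0, nu x = t1 | nu x = t2].
Proof.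
move=> x0.
have : (nu x - t0) * (nu x - t1) * (nu x - t2) = 0.
  have poly_t y : (y - t0) * (y - t1) * (y - t2) = y ^+ 3 - e1%:~R * y ^+ 2 + e2%:~R * y - e3%:~R.
    by rewrite -sum_t -sum2_t -prod_t; ring.
  rewrite poly_t -(rmorph0 nu) -x0 poly_t.
  by rewrite rmorphB rmorphD rmorphB /= (rmorphM nu e1%:~R) (rmorphM nu e2%:~R) /= !rmorphXn !rmorph_int.
move/eqP; rewrite !mulf_eq0 !subr_eq0 -orbA => /or3P[] /eqP ->;
  by [constructor 1|constructor 2|constructor 3].
Qed.

Lemma neq_t : [/\ t0 != t1, t1 != t2 & t2 != t0].
Proof.
by move: V_neq0; rewrite /V !mulf_eq0 !subr_eq0 !negb_or => /andP[/andP[-> ->] ->].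
Qed.

(* An automorphism fixing [V], a square root of the discriminant, permutes the roots evenly. *)
Lemma aut_even (nu : {rmorphism algC -> algC}) : nu w = w ->
  [\/ [/\ nu t0 = t0, nu t1 = t1 & nu t2 = t2],
      [/\ nu t0 = t1, nu t1 = t2 & nu t2 = t0]
    | [/\ nu t0 = t2, nu t1 = t0 & nu t2 = t1]].
Proof.
move=> nuw; have nuV : nu V = V := quad_fixed nuw quad_V.
have [n01 n12 n20] := neq_t.
have nuVE : (nu t0 - nu t1) * (nu t1 - nu t2) * (nu t2 - nu t0) = V.
  by rewrite -[RHS]nuV /V !rmorphM /= !rmorphB.
have D : nu t0 + nu t1 + nu t2 = t0 + t1 + t2.
  by rewrite -!rmorphD sum_t rmorph_int.
have E2 : nu t2 = t0 + t1 + t2 - nu t0 - nu t1 by rewrite -D; ring.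
have r0 : (t0 - t0) * (t0 - t1) * (t0 - t2) = 0 by ring.
have r1 : (t1 - t0) * (t1 - t1) * (t1 - t2) = 0 by ring.
have odd : V <> - V.
  move=> /eqP; rewrite -subr_eq0 opprK -mulr2n -mulr_natl mulf_eq0 (negbTE V_neq0) orbF.
  by rewrite pnatr_eq0.
have inj01 : nu t0 = nu t1 -> False by move=> /fmorph_inj E; rewrite E eqxx in n01.
have [h0|h0|h0] := aut_root nu r0; have [h1|h1|h1] := aut_root nu r1;
  rewrite h0 h1 in E2 nuVE inj01; try (by case: inj01).
- by constructor 1; split=> //; rewrite E2; ring.
- by case: odd; rewrite -{1}nuVE E2 /V; ring.
- by case: odd; rewrite -{1}nuVE E2 /V; ring.
- by constructor 2; split=> //; rewrite E2; ring.
- by constructor 3; split=> //; rewrite E2; ring.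
- by case: odd; rewrite -{1}nuVE E2 /V; ring.
Qed.

(** An automorphism that fixes [w] and moves [t0] acts on the roots as a 3-cycle, so it or its
    square is the required one. *)
Lemma exists_cycle : ~ quad n t0 -> exists sg : {rmorphism algC -> algC},
  [/\ sg w = w, sg t0 = t1, sg t1 = t2 & sg t2 = t0].
Proof.
move=> nqt; have [nu [nuw nut]] : exists nu : {rmorphism algC -> algC}, nu w = w /\ nu t0 <> t0.
  apply: contrapT => h; apply: nqt; apply: (fixed_quad n_lt0) => nu nuw.
  by apply: contrapT => ne; apply: h; exists nu.
have [[h0 _ _]|[h0 h1 h2]|[h0 h1 h2]] := aut_even nuw; first by case: nut.
  by exists nu.
by exists (nu \o nu : {rmorphism algC -> algC}); split; rewrite /= ?nuw ?(h0, h1, h2).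
Qed.

Variable sg : {rmorphism algC -> algC}.
Hypothesis sg_w : sg w = w.
Hypothesis sg_t0 : sg t0 = t1.
Hypothesis sg_t1 : sg t1 = t2.
Hypothesis sg_t2 : sg t2 = t0.

Definition fix_gens (nu : {rmorphism algC -> algC}) :=
  [/\ nu w = w, nu t0 = t0, nu t1 = t1 & nu t2 = t2].

(* The field [Q(sqrt n, t0, t1, t2)], as the fixed field of its automorphism group. *)
Definition inN (x : algC) : Prop := forall nu, fix_gens nu -> nu x = x.

Lemma inND x y : inN x -> inN y -> inN (x + y).
Proof. by move=> hx hy nu nuP; rewrite rmorphD hx ?hy. Qed.

Lemma inNM x y : inN x -> inN y -> inN (x * y).
Proof. by move=> hx hy nu nuP; rewrite rmorphM hx ?hy. Qed.

Lemma inNN x : inN x -> inN (- x).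
Proof. by move=> hx nu nuP; rewrite rmorphN hx. Qed.

Lemma inNV x : inN x -> inN x^-1.
Proof. by move=> hx nu nuP; rewrite fmorphV hx. Qed.

Lemma inN_quad x : quad n x -> inN x.
Proof. by move=> qx nu [nuw _ _ _]; exact: quad_fixed qx. Qed.

Lemma inN_t0 : inN t0. Proof. by move=> nu []. Qed.
Lemma sg3 x : inN x -> sg (sg (sg x)) = x.
Proof.
move=> Nx; apply: (Nx (sg \o sg \o sg : {rmorphism algC -> algC})).
by split; rewrite /= ?sg_w ?(sg_t0, sg_t1, sg_t2).
Qed.

Lemma inN_sg x : inN x -> inN (sg x).
Proof.
move=> Nx nu [nw n0 n1 n2].
(* On N the inverse of [sg] is its square, so this is a conjugate of [nu]. *)
have : (sg \o sg \o nu \o sg : {rmorphism algC -> algC}) x = x.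
  by apply: Nx; split; rewrite /= ?(sg_w, nw) ?(sg_t0, sg_t1, sg_t2, n0, n1, n2).
by rewrite /= -[RHS](sg3 Nx) => /fmorph_inj/fmorph_inj.
Qed.

(** An automorphism fixing [w] acts on the roots as a power of [sg]; composed with the complementary
    power it fixes N elementwise. *)
Lemma quad_fix_sg x : inN x -> sg x = x -> quad n x.
Proof.
move=> Nx sgx; apply: (fixed_quad n_lt0) => nu nuw.
have [[h0 h1 h2]|[h0 h1 h2]|[h0 h1 h2]] := aut_even nuw; first by apply: Nx.
- have : (sg \o sg \o nu : {rmorphism algC -> algC}) x = x.
    by apply: Nx; split; rewrite /= ?nuw ?sg_w // ?(h0, h1, h2) ?(sg_t0, sg_t1, sg_t2).
  by rewrite /= -{2}sgx -{2}sgx => /fmorph_inj/fmorph_inj.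
- have : (sg \o nu : {rmorphism algC -> algC}) x = x.
    by apply: Nx; split; rewrite /= ?nuw ?sg_w // ?(h0, h1, h2) ?(sg_t0, sg_t1, sg_t2).
  by rewrite /= -{2}sgx => /fmorph_inj.
Qed.

Definition ON (x : algC) : Prop := inN x /\ x \in Aint.

Lemma OND x y : ON x -> ON y -> ON (x + y).
Proof. by move=> [? ?] [? ?]; split; [exact: inND | rewrite rpredD]. Qed.

Lemma ONM x y : ON x -> ON y -> ON (x * y).
Proof. by move=> [? ?] [? ?]; split; [exact: inNM | rewrite rpredM]. Qed.

Lemma ONN x : ON x -> ON (- x).
Proof. by move=> [? ?]; split; [exact: inNN | rewrite rpredN]. Qed.

Lemma ON_sg x : ON x -> ON (sg x).
Proof. by move=> [? ?]; split; [exact: inN_sg | rewrite Aint_aut]. Qed.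

Lemma ON_qint x : qint n x -> ON x.
Proof. by move=> /(qintP n_lt0)[? ?]; split=> //; exact: inN_quad. Qed.

Lemma ON_int (z : int) : ON z%:~R.
Proof. by apply: ON_qint; exact: (qint_int n_lt0). Qed.

Lemma ON1 : ON 1.
Proof. exact: (ON_int 1). Qed.

Lemma Aint_t0 : t0 \in Aint.
Proof. by apply: (@Aint_cubic e1 e2 e3); rewrite -sum_t -sum2_t -prod_t; ring. Qed.

Lemma ON_t0 : ON t0.
Proof. split; [exact: inN_t0 | exact: Aint_t0]. Qed.

Lemma qint_fix_sg x : ON x -> sg x = x -> qint n x.
Proof. by move=> [Nx Ax] sgx; apply/(qintP n_lt0); split=> //; exact: quad_fix_sg. Qed.

Definition Tr (x : algC) := x + sg x + sg (sg x).
Definition Nm (x : algC) := x * sg x * sg (sg x).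

Lemma TrD x y : Tr (x + y) = Tr x + Tr y.
Proof. by rewrite /Tr !rmorphD; ring. Qed.

Lemma TrZ a x : sg a = a -> Tr (a * x) = a * Tr x.
Proof. by move=> sa; rewrite /Tr !rmorphM /= !sa; ring. Qed.

Lemma NmM x y : Nm (x * y) = Nm x * Nm y.
Proof. by rewrite /Nm !rmorphM /=; ring. Qed.

Lemma Nm_neq0 x : x != 0 -> Nm x != 0.
Proof. by move=> x0; rewrite /Nm !mulf_neq0 ?fmorph_eq0. Qed.

Lemma sg_Tr x : inN x -> sg (Tr x) = Tr x.
Proof. by move=> Nx; rewrite /Tr !rmorphD /= sg3 //; ring. Qed.

Lemma sg_Nm x : inN x -> sg (Nm x) = Nm x.
Proof. by move=> Nx; rewrite /Nm !rmorphM /= sg3 //; ring. Qed.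

Lemma qint_Tr x : ON x -> qint n (Tr x).
Proof.
move=> Ox; apply: qint_fix_sg; last by apply: sg_Tr; case: Ox.
by apply: OND; [apply: OND|] => //; do ?apply: ON_sg.
Qed.

Lemma qint_Nm x : ON x -> qint n (Nm x).
Proof.
move=> Ox; apply: qint_fix_sg; last by apply: sg_Nm; case: Ox.
by apply: ONM; [apply: ONM|] => //; do ?apply: ON_sg.
Qed.

Lemma sg_qint a : qint n a -> sg a = a.
Proof. by move=> /(qintP n_lt0)[qa _]; exact: quad_fixed qa. Qed.

(** * Units of N of relative norm 1, and Hilbert 90 *)

Definition unitN (x : algC) : Prop := [/\ x != 0, ON x & ON x^-1].

Lemma unitNM x y : unitN x -> unitN y -> unitN (x * y).
Proof.
by move=> [? ? ?] [? ? ?]; split; rewrite ?mulf_neq0 ?invfM //; exact: ONM.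
Qed.

Lemma unitNV x : unitN x -> unitN x^-1.
Proof. by move=> [? ? ?]; split; rewrite ?invr_eq0 ?invrK. Qed.

Lemma unitN_sg x : unitN x -> unitN (sg x).
Proof.
move=> [? ? ?]; split; rewrite ?fmorph_eq0 //; first exact: ON_sg.
by rewrite -fmorphV; exact: ON_sg.
Qed.

Hypothesis t0_real : t0^* = t0.
Hypothesis t1_conj : t1^* = t2.

Lemma conj_fix_gens (nu : {rmorphism algC -> algC}) :
  fix_gens nu -> fix_gens (Num.conj \o nu \o Num.conj : {rmorphism algC -> algC}).
Proof.
move=> [nw n0 n1 n2]; have t2c : t2^* = t1 by rewrite -t1_conj conjCK.
by split; rewrite /= ?(conj_w n_lt0) ?t0_real ?t1_conj ?t2c ?rmorphN ?nw ?n0 ?n1 ?n2 /=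
  ?(conj_w n_lt0) ?opprK ?t0_real ?t1_conj ?t2c.
Qed.

Lemma inN_conj x : inN x -> inN x^*.
Proof.
move=> Nx nu /conj_fix_gens/Nx /= E.
by rewrite -{2}E conjCK.
Qed.

Lemma ON_conj x : ON x -> ON x^*.
Proof. by move=> [? ?]; split; [exact: inN_conj | rewrite (Aint_aut Num.conj)]. Qed.

(** Complex conjugation fixes [t0] and swaps [t1] and [t2], hence conjugates [sg] into its inverse,
    as in the symmetric group on the roots. *)
Lemma sg_conj x : inN x -> sg x^* = (sg (sg x))^*.
Proof.
move=> Nx; have t2c : t2^* = t1 by rewrite -t1_conj conjCK.
have : (Num.conj \o sg \o Num.conj \o sg : {rmorphism algC -> algC}) (sg (sg x)) = sg (sg x).
  apply: (inN_sg (inN_sg Nx)); split; rewrite /= ?sg_t0 ?sg_t1 ?sg_t2.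
  - by rewrite sg_w (conj_w n_lt0) rmorphN sg_w -(conj_w n_lt0) conjCK.
  - by rewrite t1_conj sg_t2 t0_real.
  - by rewrite t2c sg_t1 t2c.
  - by rewrite t0_real sg_t0 t1_conj.
by rewrite /= sg3 // => /(congr1 Num.conj); rewrite conjCK.
Qed.

Lemma Nm_conj x : inN x -> Nm x^* = (Nm x)^*.
Proof.
move=> Nx; rewrite /Nm (sg_conj Nx) (sg_conj (inN_sg (inN_sg Nx))) (sg3 (inN_sg Nx)) !conjCM.
by ring.
Qed.

(* The real unit [rho = |x|^2] has norm 1, hence its conjugates are [rho, b, Num.conj b]
   with [|b| < 1]; the norm of [rho - 1] being a positive integer bounds [rho] below. *)
Lemma unit_norm_gap x : unitN x -> Nm x = 1 -> 1 < `|x| -> 5 <= 4 * `|x| ^+ 2.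
Proof.
move=> Ux Nx1 x_gt1; have [x0 Ox OxV] := Ux; have Nx : inN x by case: Ox.
set rho := `|x| ^+ 2; have rhoE : rho = x * x^* by rewrite /rho normCK.
have Orho : ON rho by rewrite rhoE; apply: ONM => //; exact: ON_conj.
have Nrho : inN rho by case: Orho.
have rho_conj : rho^* = rho by rewrite rhoE conjCM conjCK mulrC.
have rho_gt1 : 1 < rho by rewrite exprn_egt1.
have Nm_rho : Nm rho = 1 by rewrite rhoE NmM Nm_conj // Nx1 conjC1 mulr1.
set b := sg rho; have bc : sg b = b^*.
  by rewrite /b -{2}rho_conj sg_conj // conjCK.
have rho_b : rho * `|b| ^+ 2 = 1 by rewrite normCK mulrA -bc.
have b_lt1 : `|b| < 1.
  rewrite -(expr_lt1 (n := 2)) // -(ltr_pM2l (lt_trans ltr01 rho_gt1)) rho_b mulr1 //.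
have Nm_E : Nm (rho - 1) = (rho - 1) * `|b - 1| ^+ 2.
  by rewrite /Nm !rmorphB !rmorph1 -/b bc normCK -mulrA rmorphB /= conjC1.
set y := Nm (rho - 1) in Nm_E.
have b1 : b != 1 by apply: contraTneq b_lt1 => ->; rewrite normr1 ltxx.
have y0 : 0 < y.
  by rewrite Nm_E mulr_gt0 ?subr_gt0 // exprn_gt0 // normr_gt0 subr_eq0.
have [k Ek] : exists k : nat, y * y^* = k%:R.
  by apply: (qint_normP n_lt0); apply: qint_Nm; apply: OND => //; apply: ONN; exact: ON1.
have y1 : 1 <= y.
  have yR : y^* = y by apply/geC0_conj/ltW.
  rewrite -(expr_ge1 (n := 2)) ?(ltW y0) // expr2 -{2}yR Ek ler1n lt0n -(pnatr_eq0 algC) -Ek.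
  by rewrite mulf_neq0 // ?conjC_eq0 gt_eqF.
have b2 : `|b - 1| ^+ 2 <= 4.
  have : `|b - 1| <= 2.
    by apply: le_trans (ler_normB _ _) _; rewrite normr1 -[2]/(1 + 1) lerD2r ltW.
  move=> h; have -> : 4 = 2 ^+ 2 :> algC by rewrite -natrX.
  by rewrite ler_pXn2r ?nnegrE.
have : 1 <= (rho - 1) * 4.
  by apply: le_trans y1 _; rewrite Nm_E ler_wpM2l // subr_ge0 ltW.
by rewrite mulrBl mul1r lerBrDr mulrC -[5]/(1 + 4)%:R natrD.
Qed.

Hypothesis unit_quad4 : forall v, v != 0 -> qint n v -> qint n v^-1 -> v ^+ 4 = 1.

Lemma exists_nonboundary_unit eta : unitN eta -> Nm eta = 1 -> 1 < `|eta| ->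
  exists x, [/\ unitN x, Nm x = 1 & ~ exists e, unitN e /\ x = e / sg e].
Proof.
move=> Ueta Neta eta1; apply: contrapT => nex.
have bnd x : unitN x -> Nm x = 1 -> exists e, [/\ unitN e, Nm e = 1 & x = e / sg e].
  move=> Ux Nx1; apply: contrapT => nx; apply: nex; exists x; split=> // -[e [Ue Ex]]; apply: nx.
  have [e0 Oe OeV] := Ue; set v := Nm e.
  have qv : qint n v by exact: qint_Nm.
  have qvV : qint n v^-1.
    have -> : v^-1 = Nm e^-1 by rewrite /v /Nm !fmorphV !invfM.
    exact: qint_Nm.
  have v0 : v != 0 by exact: Nm_neq0.
  have v4 := unit_quad4 v0 qv qvV.
  have sv : sg v = v by exact: sg_qint.
  (* A factor from K does not change [e / sg e], and [Nm (e v) = v * v^3 = v^4 = 1]. *)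
  exists (e * v); split.
  - by apply: unitNM => //; split=> //; exact: ON_qint.
  - rewrite NmM {2}/Nm !sv -/v -v4; ring.
  - by rewrite rmorphM /= sv Ex; field; rewrite v0 fmorph_eq0.
have cube x : unitN x -> Nm x = 1 -> exists y, [/\ unitN y, Nm y = 1 & x = y ^+ 3].
  move=> Ux Nx; have [y [Uy Ny Ex]] := bnd x Ux Nx; have [z [Uz Nz Ey]] := bnd y Uy Ny.
  have [z0 [Nz0 _] _] := Uz.
  (* With [y = z / sg z], the quotient [y / sg y] is [z * sg (sg z) / (sg z)^2], that is
     [Nm z / (sg z)^3]. *)
  exists (sg z)^-1; split; first by apply: unitNV; exact: unitN_sg.
    by rewrite /Nm !fmorphV -!invfM -!rmorphM -/(Nm z) Nz !rmorph1 invr1.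
  rewrite Ex Ey fmorph_div -[RHS]mul1r -{1}Nz /Nm; field.
  by rewrite !fmorph_eq0 z0.
have iter k : exists y, [/\ unitN y, Nm y = 1 & eta = y ^+ (3 ^ k)].
  elim: k => [|k [y [Uy Ny ->]]]; first by exists eta; rewrite expr1.
  have [z [Uz Nz ->]] := cube y Uy Ny; exists z; split=> //.
  by rewrite -exprM -expnS.
(* If [y] is a [3^j]-th root of [eta], then [|y|^2] exceeds 1 by at least 1/4, so Bernoulli's
   inequality gives [3^j <= 4 |eta|^2 < j], which is absurd. *)
have [j lej] : exists j : nat, 4 * `|eta| ^+ 2 < j%:R.
  exists (Num.truncn (4 * `|eta| ^+ 2)).+1; apply: real_truncnS_gt.
  by rewrite realE mulr_ge0 // exprn_ge0.
have [y [Uy Ny Ey]] := iter j.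
have y1 : 1 < `|y|.
  move: eta1; rewrite Ey normrX; apply: contraTT => h.
  have yle : `|y| <= 1 by rewrite real_leNgt ?normr_real.
  by rewrite -real_leNgt ?real1 ?realX ?normr_real //; exact: exprn_ile1.
have gap := unit_norm_gap Uy Ny y1.
have y2 : 1 <= `|y| ^+ 2 by rewrite exprn_ege1 // ltW.
have := bernoulli (3 ^ j) y2; rewrite -exprM mulnC exprM -(normrX (3 ^ j) y) -Ey => h.
have : (3 ^ j)%:R < j%:R :> algC.
  apply: le_lt_trans lej; apply: (@le_trans _ _ (4 * (1 + (3 ^ j)%:R * (`|y| ^+ 2 - 1)))).
    have -> : 4 * (1 + (3 ^ j)%:R * (`|y| ^+ 2 - 1)) = (3 ^ j)%:R * (4 * `|y| ^+ 2 - 4) + 4 by ring.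
    apply: ler_wpDr => //; apply: ler_peMr => //.
    by move: gap; rewrite -[5]/(1 + 4)%:R natrD lerBrDr.
  by apply: ler_wpM2l.
by rewrite ltr_nat ltnNge ltnW // ltn_expl.
Qed.

Lemma hilbert90 eta : unitN eta -> Nm eta = 1 ->
  exists al, [/\ ON al, al != 0 & eta * sg al = al].
Proof.
move=> [eta0 Oeta OetaV] Neta; have Neta' : inN eta by case: Oeta.
pose f x := x + eta * sg x + eta * sg eta * sg (sg x).
have f_eq x : inN x -> eta * sg (f x) = f x.
  move=> Nx; have -> : eta * sg (f x) = eta * sg x + eta * sg eta * sg (sg x) + Nm eta * sg (sg (sg x)).
    by rewrite /f /Nm !rmorphD !rmorphM /=; ring.
  by rewrite Neta sg3 // /f; ring.
have Of x : ON x -> ON (f x).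
  move=> Ox; apply: OND; [apply: OND|] => //; first by apply: ONM => //; exact: ON_sg.
  by apply: ONM; [apply: ONM|]; do ?apply: ON_sg.
apply: contrapT => nex.
have f0 x : ON x -> f x = 0.
  move=> Ox; apply/eqP/negPn/negP => fx0; apply: nex; exists (f x).
  by split; [exact: Of | | apply: f_eq; case: Ox].
have Ot := ON_t0.
(* Independence of characters made explicit: the combination has the coefficients of
   [(X - t1)(X - t2)], which kills the terms in [t1] and [t2]. *)
have : t1 * t2 * f 1 - (t1 + t2) * f t0 + f (t0 ^+ 2) = (t0 - t1) * (t0 - t2).
  by rewrite /f !rmorph1 !rmorphXn /= !sg_t0 !sg_t1; ring.
rewrite (f0 1 ON1) (f0 t0 Ot) (f0 (t0 ^+ 2) (ONM Ot Ot)).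
move/eqP; rewrite !mulr0 subr0 addr0 eq_sym mulf_eq0 !subr_eq0.
by have [/negbTE -> _ n20] := neq_t; rewrite eq_sym (negbTE n20).
Qed.

(** * The ideal of K below an invariant principal ideal of N *)

Section InvariantIdeal.

Variables (eta al : algC).
Hypothesis unit_eta : unitN eta.
Hypothesis ON_al : ON al.
Hypothesis al_neq0 : al != 0.
Hypothesis eta_al : eta * sg al = al.

Definition invI (x : algC) : Prop := qint n x /\ exists z, ON z /\ x = al * z.

Let sg_al : sg al = al * eta^-1.
Proof. by rewrite -{2}eta_al; field; case: unit_eta. Qed.

Lemma invI_ideal : qideal n invI.
Proof.
split; first by move=> x [].
split; first by split; [exact: (qint_int n_lt0 0) | exists 0; rewrite mulr0; split=> //; exact: (ON_int 0)].
split.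
  exists (Nm al); split; last exact: Nm_neq0.
  split; first exact: qint_Nm.
  by exists (sg al * sg (sg al)); rewrite /Nm mulrA; split=> //; apply: ONM; do ?apply: ON_sg.
split=> [x y [qx [x' [Ox Ex]]] [qy [y' [Oy Ey]]]|r x qr [qx [x' [Ox Ex]]]].
  split; first exact: (qintD n_lt0).
  by exists (x' + y'); rewrite mulrDr -Ex -Ey; split=> //; exact: OND.
split; first exact: (qintM n_lt0).
by exists (r * x'); rewrite mulrCA -Ex; split=> //; apply: ONM => //; exact: ON_qint.
Qed.

(** The conjugates of [al] are [al] times units, so each term of the trace is a multiple of [al]. *)
Lemma invI_Tr z : ON z -> invI (Tr (al * z)).
Proof.
move=> Oz; split; first by apply: qint_Tr; exact: ONM.
have [eta0 Oeta OetaV] := unit_eta.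
exists (z + eta^-1 * sg z + eta^-1 * sg eta^-1 * sg (sg z)); split.
  apply: OND; first by apply: OND => //; apply: ONM => //; exact: ON_sg.
  by apply: ONM; [apply: ONM => //|]; do ?apply: ON_sg.
by rewrite /Tr !rmorphM /= !sg_al !rmorphM /= sg_al; ring.
Qed.

(** Let [P = (X - sg p)(X - sg (sg p))]. The sum of the conjugates of [al], weighted by the values
    of [P] at the corresponding conjugates of [p], reduces to [al * P(p)]; expanding [P] turns it
    into a combination of traces of [al p^i]. *)
Lemma prodI_invI_diff (p : algC) : ON p ->
  prodI invI ON ((p - sg p) * (p - sg (sg p)) * al).
Proof.
move=> Op; have Osp := ON_sg Op; have Ossp := ON_sg Osp.
have -> : (p - sg p) * (p - sg (sg p)) * al
  = Tr (al * (p * p)) * 1 + (Tr (al * p) * (- (sg p + sg (sg p))) + (Tr (al * 1) * (sg p * sg (sg p)) + 0)).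
  by rewrite /Tr !rmorphM !rmorph1 /=; ring.
apply: prodIS; [by apply: invI_Tr; exact: ONM | exact: ON1 |].
apply: prodIS; [exact: invI_Tr | by apply: ONN; exact: OND |].
apply: prodIS; [by apply: invI_Tr; exact: ON1 | exact: ONM | exact: prodI0].
Qed.

(* The three conjugates of the previous product add up to [e1^2 - 3 e2] of [p]. *)
Lemma prodI_invI_disc (p : algC) : ON p ->
  prodI invI ON ((Tr p ^+ 2 - 3 * Tr (p * sg p)) * al).
Proof.
move=> Op; have Np : inN p by case: Op.
have := prodI_invI_diff Op; have := prodI_invI_diff (ON_sg Op); have := prodI_invI_diff (ON_sg (ON_sg Op)).
rewrite sg3 // => h1 h2 h3.
have -> : (Tr p ^+ 2 - 3 * Tr (p * sg p)) * al
 = (p - sg p) * (p - sg (sg p)) * al + ((sg p - sg (sg p)) * (sg p - p) * al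
   + (sg (sg p) - p) * (sg (sg p) - sg p) * al).
  by rewrite /Tr !rmorphM /= sg3 //; ring.
by do 2!apply: prodI_add => //.
Qed.

Lemma invI_generates (u v : int) (p : algC) (f1 f2 : int) : ON p ->
  Tr p = f1%:~R -> Tr (p * sg p) = f2%:~R ->
  u * (e1 ^+ 2 - 3 * e2) + v * (f1 ^+ 2 - 3 * f2) = 1 ->
  prodI invI ON al.
Proof.
move=> Op E1 E2 bez.
have Et1 : Tr t0 = e1%:~R by rewrite /Tr sg_t0 sg_t1.
have Et2 : Tr (t0 * sg t0) = e2%:~R.
  by rewrite /Tr !rmorphM /= sg_t0 sg_t1 sg_t2.
have h1 := prodI_invI_disc ON_t0; have h2 := prodI_invI_disc Op; rewrite Et1 Et2 in h1; rewrite E1 E2 in h2.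
have -> : al = u%:~R * ((e1%:~R ^+ 2 - 3 * e2%:~R) * al) + v%:~R * ((f1%:~R ^+ 2 - 3 * f2%:~R) * al).
  transitivity ((u * (e1 ^+ 2 - 3 * e2) + v * (f1 ^+ 2 - 3 * f2))%:~R * al).
    by rewrite bez mul1r.
  by rewrite rmorphD !rmorphM !rmorphB !rmorphXn !rmorphM /=; ring.
apply: prodI_add; apply: prodI_scale => // a ha;
  by apply: (qidealM invI_ideal) => //; exact: (qint_int n_lt0).
Qed.

(** Descent from N to K: elements of the invariant ideal come out of the trace, so one factor [x] of
    its extension becomes one factor of the ideal itself. *)
Lemma prodI_invI_Tr (I : algC -> Prop) (t y : algC) :
  (forall z, ON z -> I (Tr (z * t) * y)) ->
  forall x, prodI invI ON x -> forall z, ON z -> prodI invI I (Tr (z * (x * t)) * y).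
Proof.
move=> It x; elim=> [|a b {}x ha Ob _ IH] z Oz.
  by rewrite mul0r mulr0 /Tr !rmorph0 !addr0 mul0r; exact: prodI0.
have sa : sg a = a by apply: sg_qint; case: ha.
have -> : Tr (z * ((a * b + x) * t)) * y = a * (Tr (z * b * t) * y) + Tr (z * (x * t)) * y.
  have -> : z * ((a * b + x) * t) = a * (z * b * t) + z * (x * t) by ring.
  by rewrite TrD (TrZ _ sa); ring.
by apply: prodIS => //; [apply: It; exact: ONM | exact: IH].
Qed.

(** A product [a b c] of elements of the ideal equals [a * sg b * sg (sg c)], a multiple of [Nm al],
    and the cofactor is integral and fixed by [sg]. Conversely [Nm al] is [al^3] times the unit
    [kap]; written as the trace of [om * Nm al], it lets the three factors [al] be descended one at
    a time. *)
Lemma invI_cube (om : algC) : ON om -> Tr om = 1 -> prodI invI ON al ->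
  forall J, qideal n J -> forall x,
    prodI invI (prodI invI (prodI invI J)) x <-> exists y, J y /\ x = Nm al * y.
Proof.
move=> Oom Tom gen J idJ x.
have [eta0 Oeta OetaV] := unit_eta; have Nal : inN al by case: ON_al.
split.
- pose C x := exists y, J y /\ x = Nm al * y.
  have C0 : C 0 by exists 0; rewrite mulr0; split=> //; exact: qideal0 idJ.
  have CD u v : C u -> C v -> C (u + v).
    move=> [u' [Ju ->]] [v' [Jv ->]]; exists (u' + v'); rewrite mulrDr; split=> //.
    exact: (qidealD idJ).
  have CCC a b c j : invI a -> invI b -> invI c -> J j -> C (a * (b * (c * j))).
    move=> [qa [za [Oza Ea]]] [qb [zb [Ozb Eb]]] [qc [zc [Ozc Ec]]] Jj.
    have Eb' : b = sg al * sg zb by rewrite -rmorphM -Eb sg_qint.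
    have Ec' : c = sg (sg al) * sg (sg zc) by rewrite -!rmorphM -Ec !sg_qint.
    have Eq : a * b * c = Nm al * (za * sg zb * sg (sg zc)).
      by rewrite Ea Eb' Ec' /Nm; ring.
    have Oq : ON (za * sg zb * sg (sg zc)).
      by apply: ONM; [apply: ONM => //|]; do ?apply: ON_sg.
    exists (za * sg zb * sg (sg zc) * j); split; last by rewrite [RHS]mulrA -Eq; ring.
    apply: (qidealM idJ) => //; apply: qint_fix_sg => //.
    apply: (mulfI (Nm_neq0 al_neq0)); rewrite -{1}(sg_Nm Nal) -rmorphM -Eq !rmorphM /=.
    by rewrite !sg_qint.
  apply: (prodI_sub C0 CD) => a y ha; elim=> [|b y' {}y hb]; first by rewrite mulr0.
  move=> hy' _ IH; rewrite mulrDr; apply: (CD _ _) => //.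
  elim: hy' => [|c j {}y' hc Jj _ IH']; first by rewrite !mulr0.
  by rewrite !mulrDr; apply: (CD _ _) => //; exact: CCC.
- move=> [y [Jy ->]].
  pose kap := eta^-1 * (eta^-1 * sg eta^-1).
  have Okap : ON kap by do 2!apply: ONM => //; exact: ON_sg.
  have Ekap : Nm al = kap * (al * (al * (al * 1))).
    rewrite /Nm !sg_al rmorphM /= sg_al /kap.
    by ring.
  have -> : Nm al * y = Tr (om * kap * (al * (al * (al * 1)))) * y.
    rewrite -(mulrA om) -Ekap.
    by rewrite (mulrC om) (TrZ _ (sg_Nm Nal)) Tom mulr1.
  apply: prodI_invI_Tr => //; last exact: ONM.
  move=> z Oz; apply: prodI_invI_Tr => // {Oz}z Oz; apply: prodI_invI_Tr => // {Oz}z Oz.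
  by apply: (qidealM idJ) => //; rewrite mulr1; exact: qint_Tr.
Qed.

(** A generator [c] in K would also generate the ideal of [al] in N, so [al = c z] with [z] a unit;
    as [sg] fixes [c], [eta] would be [z / sg z]. *)
Lemma invI_nonprincipal : prodI invI ON al -> ~ (exists e, unitN e /\ eta = e / sg e) ->
  ~ exists c, c != 0 /\ forall x, invI x <-> exists z, qint n z /\ x = c * z.
Proof.
move=> gen neta [c [c0 cP]]; apply: neta.
have [qc [z' [Oz' Ec]]] : invI c.
  by apply/cP; exists 1; rewrite mulr1; split=> //; exact: (qint_int n_lt0 1).
have [z [Oz Ez]] : exists z, ON z /\ al = c * z.
  elim: gen => [|a b x /cP[u [qu ->]] Ob _ [v [Ov ->]]].
    by exists 0; rewrite mulr0; split=> //; exact: (ON_int 0).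
  exists (u * b + v); split; last by ring.
  by apply: OND => //; apply: ONM => //; exact: ON_qint.
have z0 : z != 0 by apply: contraNneq al_neq0 => z0; rewrite Ez z0 mulr0.
have zz : z^-1 = z'.
  have zz1 : z * z' = 1 by apply: (mulfI c0); rewrite mulrA -Ez -Ec mulr1.
  by rewrite -[z'](mulKf z0) zz1 mulr1.
exists z; split; first by split=> //; rewrite zz.
have : eta * sg al = al := eta_al.
rewrite Ez rmorphM /= (sg_qint qc) => E; apply: (mulIf (_ : c * sg z != 0)).
  by rewrite mulf_neq0 // fmorph_eq0.
by rewrite E; field; rewrite fmorph_eq0.
Qed.

End InvariantIdeal.

(** * A unit of infinite order in the order Z[t0] *)

Definition lin (v : int * int * int) : algC :=
  v.1.1%:~R + v.1.2%:~R * t0 + v.2%:~R * t0 ^+ 2.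

Lemma ON_lin v : ON (lin v).
Proof.
have Ot := ON_t0; apply: OND; first apply: OND; try apply: ONM; try exact: ON_int => //.
exact: Ot.
exact: (ONM Ot Ot).
Qed.

Lemma conj_lin v : (lin v)^* = lin v.
Proof. by rewrite /lin !conjCD !conjCM t0_real !rmorph_int. Qed.

Lemma sg_lin v : sg (lin v) = v.1.1%:~R + v.1.2%:~R * t1 + v.2%:~R * t1 ^+ 2.
Proof. by rewrite /lin !rmorphD !rmorphM /= sg_t0 !rmorph_int. Qed.

Lemma sg2_lin v : sg (sg (lin v)) = (sg (lin v))^*.
Proof. by rewrite -[in RHS](conj_lin v) (sg_conj (ON_lin v).1) conjCK. Qed.

Lemma lin_neq0 v : v <> (0, 0, 0) -> lin v != 0.
Proof.
move: v => [[x y] z] nv; apply/negP => /eqP l0; apply: nv.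
have [n01 n12 n20] := neq_t.
have g0 : x%:~R + y%:~R * t0 + z%:~R * t0 ^+ 2 = 0 :> algC := l0.
have g1 : x%:~R + y%:~R * t1 + z%:~R * t1 ^+ 2 = 0 :> algC.
  by have := sg_lin (x, y, z); rewrite l0 rmorph0 => /esym.
have g2 : x%:~R + y%:~R * t2 + z%:~R * t2 ^+ 2 = 0 :> algC.
  have := congr1 sg g1; rewrite rmorph0 => <-.
  by rewrite !rmorphD !rmorphM /= sg_t1 !rmorph_int.
have h0 : y%:~R + z%:~R * (t0 + t1) = 0 :> algC.
  have : t0 - t1 != 0 by rewrite subr_eq0.
  move/mulfI; apply; rewrite mulr0 -[RHS](subrr 0) -{1}g0 -g1; ring.
have h1 : y%:~R + z%:~R * (t1 + t2) = 0 :> algC.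
  have : t1 - t2 != 0 by rewrite subr_eq0.
  move/mulfI; apply; rewrite mulr0 -[RHS](subrr 0) -{1}g1 -g2; ring.
have z0 : z%:~R = 0 :> algC.
  have : t2 - t0 != 0 by rewrite subr_eq0.
  move/mulfI; apply; rewrite mulr0 -[RHS](subrr 0) -{1}h1 -h0; ring.
have y0 : y%:~R = 0 :> algC by rewrite z0 mul0r addr0 in h0.
have x0 : x%:~R = 0 :> algC by rewrite z0 y0 !mul0r !addr0 in g0.
by move/eqP: x0; move/eqP: y0; move/eqP: z0; rewrite !intr_eq0 => /eqP -> /eqP -> /eqP ->.
Qed.

Lemma Nm_lin_int v : exists k : int, Nm (lin v) = k%:~R.
Proof.
have [q A] := (qintP n_lt0 _).1 (qint_Nm (ON_lin v)).
have R : (Nm (lin v))^* = Nm (lin v).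
  by rewrite /Nm sg2_lin !conjCM conj_lin conjCK; ring.
by apply: Crat_Aint_intr => //; exact: (quad_real_Crat n_lt0).
Qed.

(** The real conjugate is less than [M / Q^2], while the two complex ones are at most [Q C]; the
    powers of [Q] cancel in the norm, so [B] is independent of [eps]. *)
Lemma exists_lin_bound : exists B : nat, forall eps : algC, 0 < eps ->
  exists v, [/\ lin v != 0, `|lin v| < eps & `|Nm (lin v)| <= B%:R].
Proof.
have t0R : t0 \is Num.real by apply/CrealP.
(* The approximation lemma wants a totally ordered field, so it is applied to [t0] as a real
   algebraic number. *)
pose tau : algR := in_algR t0R.
pose M : algC := 2 * (2 + `|t0| + t0 ^+ 2).
pose C : algC := 1 + `|t1| + `|t1| ^+ 2.
have C0 : 0 <= C by rewrite !addr_ge0 // exprn_ge0.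
have M0 : 0 <= M by rewrite mulr_ge0 // !addr_ge0 // real_exprn_even_ge0.
exists (Num.truncn (M * C ^+ 2)).+1 => eps eps0.
pose Q := (Num.truncn (M / eps)).+1.
have MQ : M < eps * Q%:R.
  rewrite mulrC -ltr_pdivrMr //; apply: real_truncnS_gt.
  by rewrite realE divr_ge0 // ltW.
have [x [y [z [nv [bx by' bz] small]]]] := small_quadratic_form tau (ltn0Sn _ : (0 < Q)%N).
pose v := (x, y, z).
have smallC : `|lin v| * Q%:R ^+ 2 < M.
  have : algRval (`|x%:~R + y%:~R * tau + z%:~R * tau ^+ 2| * Q%:R ^+ 2)
     < algRval (2 * (2 + `|tau| + tau ^+ 2)) by exact: small.
  by rewrite !(rmorphM, rmorphD, rmorphXn, rmorph_nat, rmorph_int) /=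
    !(rmorphM, rmorphD, rmorphXn, rmorph_nat, rmorph_int) /=.
have Q1 : 1 <= Q%:R :> algC by rewrite ler1n.
exists v; split; first exact: lin_neq0.
  have : `|lin v| * Q%:R < eps * Q%:R.
    apply: le_lt_trans MQ; apply: le_trans (ltW smallC).
    by rewrite expr2 mulrA ler_peMr // mulr_ge0.
  by rewrite ltr_pM2r // (lt_le_trans ltr01).
have sgv : `|sg (lin v)| <= Q%:R * C.
  rewrite sg_lin /=; apply: le_trans (ler_normD _ _) _.
  have bd (u : int) : `|u| <= Q%:Z -> `|u%:~R| <= Q%:R :> algC.
    by move=> h; rewrite -intr_norm pmulrn ler_int.
  rewrite /C mulrDr; apply: lerD; last by rewrite normrM normrX ler_wpM2r ?exprn_ge0 ?bd.
  apply: le_trans (ler_normD _ _) _; rewrite mulrDr mulr1.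
  by apply: lerD; [exact: bd | rewrite normrM ler_wpM2r ?bd].
have -> : `|Nm (lin v)| = `|lin v| * `|sg (lin v)| ^+ 2.
  by rewrite /Nm sg2_lin !normrM norm_conjC -mulrA.
apply: (@le_trans _ _ (M * C ^+ 2)).
  apply: (@le_trans _ _ (`|lin v| * (Q%:R * C) ^+ 2)).
    by rewrite ler_wpM2l // lerXn2r ?nnegrE // mulr_ge0.
  by rewrite exprMn mulrA ler_wpM2r ?exprn_ge0 // ltW.
by apply/ltW/real_truncnS_gt; rewrite realE mulr_ge0 // exprn_ge0.
Qed.

Lemma exists_unit : exists eta, [/\ unitN eta, Nm eta = 1 & 1 < `|eta|].
Proof.
have [B exB] := exists_lin_bound.
pose good v := lin v != 0 /\ `|Nm (lin v)| <= B%:R.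
have step (v : int * int * int) : exists v', good v -> good v' /\ `|lin v'| < `|lin v|.
  have [[v0 _]|ng] := pselect (good v); last by exists v.
  by have [|v' [? ? ?]] := exB `|lin v|; [rewrite normr_gt0 | exists v'].
have [next nextP] := choice step.
have [v0 [v00 _ v0B]] := exB 1 ltr01.
pose a i := iter i next v0.
have ga i : good (a i) by elim: i => [|i IH]; [split | case: (nextP _ IH)].
have lt_a i j : (i < j)%N -> `|lin (a j)| < `|lin (a i)|.
  have lt1 k : `|lin (a k.+1)| < `|lin (a k)| by case: (nextP _ (ga k)).
  elim: j => // j IH; rewrite ltnS leq_eqVlt => /orP[/eqP ->|/IH h]; first exact: lt1.
  exact: lt_trans (lt1 j) h.
(* Every norm in the sequence divides [D], hence every [lin (a k)] does: two terms congruent modulo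
   [D] divide each other, whatever their norms. *)
pose D := B`!; have D0 : (0 < D)%N := fact_gt0 _.
have res (v : int * int * int) : exists r : 'I_D * 'I_D * 'I_D, exists g,
    lin v = lin (r.1.1%:Z, r.1.2%:Z, r.2%:Z) + D%:R * lin g.
  move: v => [[x y] z]; have [x0 [x1 Ex]] := ordinal_modz x D0.
  have [y0 [y1 Ey]] := ordinal_modz y D0; have [z0 [z1 Ez]] := ordinal_modz z D0.
  exists (x0, y0, z0), (x1, y1, z1); rewrite /lin /= Ex Ey Ez !intrD !intrM -!pmulrn; ring.
have [r rP] := choice res.
have [|i [j [nij Eij]]] := @pigeonhole _ _ (fun i : 'I_(D * D * D).+1 => r (a i)) _.
  by rewrite !card_prod !card_ord.
wlog ltij : i j nij Eij / (i < j)%N.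
  move=> W; have [l|l|/ord_inj E] := ltngtP i j; first exact: (W i j).
    by apply: (W j i) => //; rewrite eq_sym.
  by rewrite E eqxx in nij.
have [g Eg] : exists g, lin (a i) = lin (a j) + D%:R * g /\ ON g.
  have [gi Ei] := rP (a i); have [gj Ej] := rP (a j).
  exists (lin gi - lin gj); rewrite Ei Ej Eij; split; first by ring.
  by apply: OND; [|apply: ONN]; exact: ON_lin.
case: Eg => Eg Og.
have divD k : ON (D%:R / lin (a k)).
  have [k0 kB] := ga k; have [N EN] := Nm_lin_int (a k).
  have N0 : N%:~R != 0 :> algC by rewrite -EN Nm_neq0.
  have NB : (`|N| <= B)%N by rewrite -(ler_nat algC) natr_absz intr_norm -EN.
  have N1 : (0 < `|N|)%N by rewrite absz_gt0 -(intr_eq0 algC).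
  have /dvdzP[e Ee'] : (N %| D%:Z)%Z by rewrite dvdzE dvdn_fact // N1.
  have Ee : D%:R = e%:~R * N%:~R :> algC by rewrite pmulrn Ee' intrM.
  have -> : D%:R / lin (a k) = e%:~R * (sg (lin (a k)) * sg (sg (lin (a k)))).
    by rewrite Ee -EN /Nm; field.
  by apply: ONM; [exact: ON_int | apply: ONM; do ?apply: ON_sg; exact: ON_lin].
have [ai0 _] := ga i; have [aj0 _] := ga j.
pose eta := lin (a i) / lin (a j).
have eta0 : eta != 0 by rewrite mulf_neq0 ?invr_eq0.
have Ueta : unitN eta.
  split=> //.
    have -> : eta = 1 + D%:R / lin (a j) * g by rewrite /eta Eg; field.
    by apply: OND; [exact: ON1 | exact: ONM].
  have -> : eta^-1 = 1 - D%:R / lin (a i) * g.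
    have Ej : lin (a j) = lin (a i) - D%:R * g by rewrite Eg; ring.
    by rewrite /eta invf_div Ej; field.
  by apply: OND; [exact: ON1 | apply: ONN; exact: ONM].
have eta_gt1 : 1 < `|eta|.
  by rewrite normf_div ltr_pdivlMr ?normr_gt0 // mul1r; exact: lt_a.
(* The norm of [eta] is an invertible integer, 1 or -1; squaring makes it 1. *)
exists (eta ^+ 2); split; first exact: unitNM.
  have [_ Oeta OetaV] := Ueta.
  have [Ni ENi] := Nm_lin_int (a i); have [Nj ENj] := Nm_lin_int (a j).
  have NmV x : Nm x^-1 = (Nm x)^-1 by rewrite /Nm !fmorphV !invfM.
  have Qeta : Nm eta \in Crat.
    by rewrite /eta NmM NmV ENi ENj rpred_div ?rpred_int.
  have [u Eu] : exists u : int, Nm eta = u%:~R.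
    by apply: Crat_Aint_intr => //; case/(qintP n_lt0): (qint_Nm Oeta).
  have [u' Eu'] : exists u : int, (Nm eta)^-1 = u%:~R.
    by apply: Crat_Aint_intr; rewrite ?rpredV // -NmV; case/(qintP n_lt0): (qint_Nm OetaV).
  have : (u * u')%:~R = 1 :> algC.
    have Nm0 : Nm eta != 0 by exact: Nm_neq0.
    by rewrite intrM -Eu -Eu' mulfV.
  move=> /eqP; rewrite -[1]/(1%:~R) eqr_int => /eqP uu'.
  have : u \is a GRing.unit by apply/unitrP; exists u'; rewrite mulrC.
  rewrite NmM Eu -intrM => /orP[] /eqP ->; by rewrite ?mulrNN mulr1.
by rewrite normrX exprn_egt1.
Qed.

(** The two Bezout relations stand for unramifiedness: the first puts [al] into the extension of the
    invariant ideal, the second makes a combination of 1, of trace 3, and [p], of trace [f1], into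
    an element of trace 1. *)
Lemma class_number_dvd3_cubic (p : algC) (f1 f2 u v u' v' : int) :
  ON p -> Tr p = f1%:~R -> Tr (p * sg p) = f2%:~R ->
  u * (e1 ^+ 2 - 3 * e2) + v * (f1 ^+ 2 - 3 * f2) = 1 ->
  u' * 3 + v' * f1 = 1 ->
  exists h : nat, has_class_number n h /\ (3 %| h)%N.
Proof.
move=> Op Tp Tpp bez bez'.
have [eta0 [Ueta0 Neta0 eta0_gt1]] := exists_unit.
have [x [Ux Nx nx]] := exists_nonboundary_unit Ueta0 Neta0 eta0_gt1.
have [al [Oal al0 Eal]] := hilbert90 Ux Nx.
have gen := invI_generates Ux Oal al0 Eal Op Tp Tpp bez.
pose om := u'%:~R * 1 + v'%:~R * p.
have Oom : ON om by apply: OND; apply: ONM => //; try exact: ON_int; exact: ON1.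
have Tom : Tr om = 1.
  rewrite /om TrD !TrZ ?rmorph_int // Tp /Tr !rmorph1.
  have E : (u' * 3 + v' * f1)%:~R = 1 :> algC by rewrite bez'.
  by rewrite -[RHS]E intrD !intrM; ring.
apply: (class_number_dvd3 n_lt0 (invI_ideal Oal al0) (qint_Nm Oal) (Nm_neq0 al0)).
- exact: (invI_cube Ux Oal al0 Eal Oom Tom gen).
- exact: (invI_nonprincipal al0 Eal gen nx).
Qed.

End Cubic.

(** * Cube roots of real quadratic units *)

(** For [T >= 3] the number lies strictly between [T^2] and the preceding or following square. *)
Lemma discr_nonsquare (s T k : int) : s = 1 \/ s = -1 -> 3 <= T -> T ^+ 2 - 4 * s <> k ^+ 2.
Proof.
move=> hs T3 E.
wlog k0 : k E / 0 <= k.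
  move=> W; have [k0|k0] := leP 0 k; first exact: (W k).
  by apply: (W (- k)); rewrite ?sqrrN // oppr_ge0 ltW.
rewrite !expr2 in E; case: hs => hs; rewrite hs in E.
- have : k < T by nia.
  have : T - 1 < k by nia.
  lia.
- have : T < k by nia.
  have : k < T + 1 by nia.
  lia.
Qed.

Lemma discr_not_rat_square (s T : int) (x : algC) : s = 1 \/ s = -1 -> 3 <= T ->
  x \in Crat -> x ^+ 2 <> (T ^+ 2 - 4 * s)%:~R.
Proof.
move=> hs T3 Qx Ex.
have [|k Ek] := Crat_Aint_intr Qx.
  by apply: (@Aint_cubic 0 (- (T ^+ 2 - 4 * s)) 0); rewrite rmorphN /= -Ex; ring.
apply: (@discr_nonsquare s T k hs T3); apply: (@intr_inj algC).
by rewrite -Ex Ek rmorphXn.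
Qed.

(* A unit of trace [t] and norm 1 satisfies [t^2 - 4 = 4 n b^2 <= 0], so [t] is one of
   [0, 1, -1, 2, -2], and [t = 1, -1] makes [-3 n] a square. *)
Lemma imaginary_unit4 (n : int) (v : algC) : n < 0 ->
  (forall b : rat, b ^+ 2 * n%:~R <> - 3) ->
  v != 0 -> qint n v -> qint n v^-1 -> v ^+ 4 = 1.
Proof.
move=> n0 hn v0 qv qvV.
have [k Ek] := qint_normP n0 qv; have [k' Ek'] := qint_normP n0 qvV.
have kk' : (k * k')%:R = 1 :> algC.
  by rewrite natrM -Ek -Ek' (fmorphV Num.conj) /=; field; rewrite conjC_eq0 v0.
have k1 : k = 1%N.
  by move/eqP: kk'; rewrite -[1]/(1%:R) eqr_nat muln_eq1 => /andP[/eqP].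
have [a [b [Ev [[t Et] _]]]] := qv.
set w := sqrtC _ in Ev; have w2 : w ^+ 2 = n%:~R := sqr_w n.
have N1 : a ^+ 2 - n%:~R * b ^+ 2 = 1.
  apply: (fmorph_inj (ratr : rat -> algC)); rewrite /= rmorph1.
  have E : ratr (a ^+ 2 - n%:~R * b ^+ 2) = ratr a ^+ 2 - w ^+ 2 * ratr b ^+ 2.
    by rewrite w2 rmorphB /= (rmorphM ratr n%:~R) /= !(rmorphXn ratr) /= ratr_int.
  rewrite E.
  have : v * v^* = 1 by rewrite Ek k1.
  by rewrite Ev (conj_ratrDw n0) -/w => <-; ring.
have Ev2 : v ^+ 2 = t%:~R * v - 1.
  rewrite -(ratr_int algC t) -Et (rmorphM ratr 2) /= ratr_nat.
  have N1C : ratr a ^+ 2 - w ^+ 2 * ratr b ^+ 2 = 1.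
    by rewrite -[RHS](rmorph1 (ratr : rat -> algC)) -N1 rmorphB /= (rmorphM ratr n%:~R) /=
      !(rmorphXn ratr) /= ratr_int w2.
  by rewrite -[X in _ = _ - X]N1C Ev; ring.
have nQ : n%:~R < 0 :> rat by rewrite ltrz0.
have a2 : a ^+ 2 = 1 + n%:~R * b ^+ 2 by move/eqP: N1; rewrite subr_eq => /eqP.
have Et2 : t%:~R ^+ 2 = 4 + 4 * (n%:~R * b ^+ 2) :> rat.
  by rewrite -Et exprMn a2; ring.
have nb : n%:~R * b ^+ 2 <= 0 by rewrite nmulr_rle0 // sqr_ge0.
have t2 : t ^+ 2 <= 4.
  by rewrite -(ler_int rat) rmorphXn /= Et2 -[X in _ <= X](addr0 4) lerD2l pmulr_rle0.
have E4 : v ^+ 4 = (v ^+ 2) ^+ 2 by rewrite -exprM.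
have : [\/ t = 0, t ^+ 2 = 4 | t ^+ 2 = 1].
  have : [\/ t = 0, t = 2 \/ t = - 2 | t = 1 \/ t = - 1].
    have [h1 h2] : -2 <= t /\ t <= 2 by rewrite expr2 in t2; split; nia.
    have [|[|[|[|]]]] : t = 0 \/ t = 2 \/ t = -2 \/ t = 1 \/ t = -1 by lia.
    - by constructor 1.
    - by constructor 2; left.
    - by constructor 2; right.
    - by constructor 3; left.
    - by constructor 3; right.
  by case=> [->|[]->|[]->]; [constructor 1|constructor 2|constructor 2|constructor 3|constructor 3].
case=> [t0|t4|t1].
- by rewrite E4 Ev2 t0 mul0r sub0r sqrrN expr1n.
- have b0 : b = 0.
    have : 4 * (n%:~R * b ^+ 2) = 0.
      by apply: (@addrI _ 4); rewrite -Et2 -rmorphXn t4 addr0.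
    by move/eqP; rewrite !mulf_eq0 pnatr_eq0 (lt_eqF nQ) orbb => /eqP.
  have v2 : v ^+ 2 = 1.
    by rewrite Ev b0 rmorph0 mul0r addr0 -(rmorphXn ratr) /= a2 b0 expr0n mulr0 addr0 rmorph1.
  by rewrite E4 v2 expr1n.
- case: (hn (2 * b)).
  have -> : (2 * b) ^+ 2 * n%:~R = t%:~R ^+ 2 - 4 by rewrite Et2; ring.
  by rewrite -rmorphXn t1.
Qed.

Section CubeRoot.

Variables (s T : int) (u : algC).
Hypothesis hs : s = 1 \/ s = -1.
Hypothesis T3 : 3 <= T.
Hypothesis u_neq0 : u != 0.
Hypothesis Eu : u ^+ 3 = E_s s T.

Let d : algC := sqrtC (T ^+ 2 - 4 * s)%:~R.
Let u' : algC := s%:~R / u.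

Lemma s_sqr : s%:~R ^+ 2 = 1 :> algC.
Proof. by case: hs => ->; rewrite ?sqrrN expr1n. Qed.

Lemma disc_sqr : d ^+ 2 = T%:~R ^+ 2 - 4 * s%:~R.
Proof. by rewrite sqrtCK rmorphB rmorphXn rmorphM. Qed.

Lemma cube_root_mul : u * u' = s%:~R.
Proof. by rewrite /u'; field. Qed.

Lemma cube_root_conj : u' ^+ 3 = (T%:~R - d) / 2.
Proof.
apply: (mulfI (expf_neq0 3 u_neq0)); rewrite -exprMn cube_root_mul Eu /E_s -/d.
have -> : (T%:~R + d) / 2 * ((T%:~R - d) / 2) = (T%:~R ^+ 2 - d ^+ 2) / 4 by field.
by rewrite disc_sqr exprSr s_sqr; field.
Qed.

Lemma cube_root_sum : T%:~R = u ^+ 3 + u' ^+ 3.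
Proof. by rewrite cube_root_conj Eu /E_s -/d; field. Qed.

Lemma cube_root_diff : d = u ^+ 3 - u' ^+ 3.
Proof. by rewrite cube_root_conj Eu /E_s -/d; field. Qed.

End CubeRoot.

Lemma cube_root_trace (s T j : int) (u : algC) : s = 1 \/ s = -1 -> u != 0 ->
  u ^+ 3 = E_s s T -> u + s%:~R / u = j%:~R -> T = j ^+ 3 - 3 * s * j.
Proof.
move=> hs u0 Eu Ej; apply: (@intr_inj algC).
rewrite (cube_root_sum hs u0 Eu) rmorphB rmorphXn /= !intrM -Ej.
by have := cube_root_mul s u0; set u' := _ / u => <-; ring.
Qed.

(** As [u] and [u' = s/u] have sum [j] and product [s], only membership in Q(sqrt M) is at stake:
    [u^3 - u'^3] is an integer multiple of [sqrt M], and dividing by [u^2 + u u' + u'^2 = j^2 - s]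
    gives [u - u']. *)
Lemma cube_root_qunit (s T M r j : int) (u : algC) : s = 1 \/ s = -1 -> 3 <= T ->
  T ^+ 2 - 4 * s = M * r ^+ 2 -> u != 0 -> u ^+ 3 = E_s s T ->
  u + s%:~R / u = j%:~R -> qunit M u.
Proof.
move=> hs T3 ET u0 Eu Ej; set w : algC := sqrtC M%:~R.
have w2 : w ^+ 2 = M%:~R by rewrite sqrtCK.
set u' := s%:~R / u in Ej; have uu' : u * u' = s%:~R := cube_root_mul s u0.
have [e Ee] : exists e : int, u ^+ 3 - u' ^+ 3 = e%:~R * w.
  rewrite -(cube_root_diff hs u0 Eu); set d := sqrtC _.
  have : d ^+ 2 = (r%:~R * w) ^+ 2 by rewrite sqrtCK ET exprMn w2 rmorphM rmorphXn mulrC.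
  move/eqP; rewrite eqf_sqr => /orP[] /eqP ->; first by exists r.
  by exists (- r); rewrite rmorphN mulNr.
have d0 : u ^+ 3 - u' ^+ 3 != 0.
  rewrite -(cube_root_diff hs u0 Eu) sqrtC_eq0 intr_eq0; apply/eqP => E.
  by apply: (@discr_nonsquare s T 0 hs T3); rewrite E.
have ded : (u - u') * (j%:~R ^+ 2 - s%:~R) = e%:~R * w.
  by rewrite -Ee -Ej -uu'; ring.
have js0 : j%:~R ^+ 2 - s%:~R != 0 :> algC.
  by apply: contraNneq d0 => E; rewrite Ee -ded E mulr0.
pose a : rat := j%:~R / 2; pose b : rat := e%:~R / (2 * (j%:~R ^+ 2 - s%:~R)).
have aC : ratr a = j%:~R / 2 :> algC.
  by rewrite (fmorph_div ratr j%:~R) /= ratr_int ratr_nat.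
have bC : ratr b = e%:~R / (2 * (j%:~R ^+ 2 - s%:~R)) :> algC.
  rewrite (fmorph_div ratr e%:~R) /= (rmorphM ratr 2) /= rmorphB (rmorphXn ratr) /=.
  by rewrite !ratr_int ratr_nat.
have uE : u = ratr a + ratr b * w.
  rewrite aC bC mulrAC -ded -Ej; field; rewrite Ej js0.
  by [].
have u'E : u' = ratr a - ratr b * w.
  rewrite aC bC mulrAC -ded -Ej; field; rewrite Ej js0.
  by [].
have tr : 2 * a = j%:~R by rewrite /a; field.
have nm : a ^+ 2 - M%:~R * b ^+ 2 = s%:~R.
  apply: (fmorph_inj (ratr : rat -> algC)); rewrite /= ratr_int -uu' uE u'E.
  rewrite rmorphB /= (rmorphM ratr M%:~R) /= !(rmorphXn ratr) /= ratr_int -w2; ring.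
split; first by exists a, b; split=> //; split; [exists j | exists s].
split=> //.
have -> : u^-1 = s%:~R * u'.
  by apply: (mulfI u0); rewrite mulfV // mulrCA uu' -expr2 s_sqr.
exists (s%:~R * a), (- s%:~R * b); split.
  rewrite u'E (rmorphM ratr s%:~R) /= mulNr rmorphN /= (rmorphM ratr s%:~R) /= ratr_int -/w; ring.
split; first by exists (s * j); rewrite intrM -tr; ring.
exists s; rewrite -[RHS]nm.
have s2 : s%:~R ^+ 2 = 1 :> rat by case: hs => ->; rewrite ?sqrrN expr1n.
by rewrite !exprMn sqrrN s2; ring.
Qed.

(** The conditions on [c] say that [c] is a root of [X^3 - 3 s X - T] modulo 9 and that [c^2 + 2 s]
    is prime to 3. *)
Lemma class_number_dvd3_unit (s T M r c m k : int) (u : algC) :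
  s = 1 \/ s = -1 -> 3 <= T -> 0 < M -> T ^+ 2 - 4 * s = M * r ^+ 2 ->
  T - c ^+ 3 + 3 * s * c = 9 * m -> (c ^+ 2 + 2 * s) ^+ 2 = 1 + 3 * k ->
  0 < u -> u ^+ 3 = E_s s T -> (forall j : int, u + s%:~R / u <> j%:~R) ->
  exists h : nat, has_class_number (- 3 * M) h /\ (3 %| h)%N.
Proof.
move=> hs T3 M0 ET Em Ek u0 Eu nint; set n := - 3 * M.
have n0 : n < 0 by rewrite /n; lia.
have un0 : u != 0 by rewrite gt_eqF.
pose d : algC := sqrtC (T ^+ 2 - 4 * s)%:~R.
have d0 : d != 0.
  rewrite sqrtC_eq0 intr_eq0; apply/eqP => E.
  by apply: (@discr_nonsquare s T 0 hs T3); rewrite E.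
pose u' := s%:~R / u.
have uu' : u * u' = s%:~R := cube_root_mul s un0.
pose z : algC := sqrtC (- 3)%:~R.
have z2 : z ^+ 2 = - 3 by rewrite sqrtCK rmorphN.
have z0 : z != 0 by rewrite sqrtC_eq0 intr_eq0.
pose de := u - u'; pose t0 := u + u'.
have de2 : de ^+ 2 = t0 ^+ 2 - 4 * s%:~R by rewrite -uu' /de /t0; ring.
have t03 : t0 ^+ 3 = 3 * s%:~R * t0 + T%:~R.
  rewrite (cube_root_sum hs un0 Eu) -/u'.
  by rewrite -uu' /t0; ring.
have ded : de * (t0 ^+ 2 - s%:~R) = d.
  have -> : d = u ^+ 3 - u' ^+ 3 := cube_root_diff hs un0 Eu.
  by rewrite -uu' /t0 /de; ring.
pose t1 := (- t0 + z * de) / 2; pose t2 := (- t0 - z * de) / 2.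
have sum1 : t0 + t1 + t2 = 0%:~R by rewrite /t1 /t2; field.
have zde : (z * de) ^+ 2 = - 3 * (t0 ^+ 2 - 4 * s%:~R) by rewrite exprMn z2 de2.
have t12 : t1 * t2 = t0 ^+ 2 - 3 * s%:~R.
  have -> : t1 * t2 = (t0 ^+ 2 - (z * de) ^+ 2) / 4 by rewrite /t1 /t2; field.
  by rewrite zde; field.
have t12s : t1 + t2 = - t0 by rewrite /t1 /t2; field.
have sum2 : t0 * t1 + t1 * t2 + t2 * t0 = (- 3 * s)%:~R.
  have -> : t0 * t1 + t1 * t2 + t2 * t0 = t0 * (t1 + t2) + t1 * t2 by ring.
  by rewrite t12 t12s rmorphM rmorphN; ring.
have prod3 : t0 * t1 * t2 = T%:~R.
  rewrite -mulrA t12 mulrBr -exprS t03; ring.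
set V := (t0 - t1) * (t1 - t2) * (t2 - t0).
(* Its square, the discriminant [-27 (T^2 - 4 s)], is [(3 r)^2] times [-3 M], so the square root
   lies in K. *)
have EV : V = - 3 * z * d.
  have -> : V = - (z * de) * (9 * t0 ^+ 2 - (z * de) ^+ 2) / 4 by rewrite /V /t1 /t2; field.
  by rewrite zde -ded; field.
have V0 : V != 0 by rewrite EV !mulf_neq0 // oppr_eq0 pnatr_eq0.
have qV : quad n V.
  have : V ^+ 2 = (3 * r%:~R * sqrtC n%:~R) ^+ 2.
    have dM : d ^+ 2 = M%:~R * r%:~R ^+ 2 by rewrite sqrtCK ET rmorphM rmorphXn.
    rewrite EV !exprMn z2 dM sqrtCK /n rmorphM rmorphN; ring.
  have q3 : quad n (3 * r%:~R * sqrtC n%:~R).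
    by apply: quadM; [apply: quadM; [exact: (quad_int n0 3) | exact: quad_int] | exact: quad_w].
  by move/eqP; rewrite eqf_sqr => /orP[] /eqP -> //; exact: quadN.
have uR : u^* = u by apply/geC0_conj/ltW.
have u'R : u'^* = u' by rewrite /u' fmorph_div rmorph_int /= uR.
have t0R : t0^* = t0 by rewrite /t0 conjCD uR u'R.
have deR : de^* = de by rewrite /de rmorphB /= uR u'R.
have zc : z^* = - z by exact: conj_w.
have t1c : t1^* = t2.
  by rewrite /t1 /t2 fmorph_div rmorphD rmorphN rmorphM /= t0R zc deR rmorph_nat mulNr.
have At0 : t0 \in Aint := Aint_t0 sum1 sum2 prod3.
have nq : ~ quad n t0.
  move=> qt; have [j Ej] := Crat_Aint_intr (quad_real_Crat n0 qt t0R) At0.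
  exact: (nint j Ej).
have [sg [sgw sg0 sg1 sg2]] := exists_cycle n0 sum1 sum2 prod3 qV V0 nq.
have u4 v : v != 0 -> qint n v -> qint n v^-1 -> v ^+ 4 = 1.
  apply: imaginary_unit4 => // b Eb; apply: (@discr_not_rat_square s T (ratr (r%:~R / b)) hs T3).
    exact: Crat_rat.
  have b0 : b != 0 by apply: contra_eqN Eb => /eqP ->; rewrite expr0n mul0r eq_sym oppr_eq0.
  have M1 : b ^+ 2 * M%:~R = 1.
    apply: (@mulfI _ (- 3)); first by rewrite oppr_eq0 pnatr_eq0.
    by rewrite mulr1 -[RHS]Eb /n rmorphM rmorphN; ring.
  have E : (r%:~R / b) ^+ 2 = (T ^+ 2 - 4 * s)%:~R :> rat.
    have M1' : M%:~R = (b ^+ 2)^-1 :> rat.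
      by apply: (mulfI (expf_neq0 2 b0)); rewrite M1 mulfV // expf_neq0.
    by rewrite ET rmorphM rmorphXn /= M1'; field.
  by rewrite -(rmorphXn ratr) /= E ratr_int.
(* [p] is integral because [T = c^3 - 3 s c] modulo 9. The quantity [e1^2 - 3 e2] is [9 s] for
   [t0] and 1 modulo 3 for [p], so the two of them are coprime. *)
pose p := (t0 - c%:~R) ^+ 2 / 3; pose f1 := c ^+ 2 + 2 * s.
pose f2 := (c ^+ 2 - s) ^+ 2 + 6 * c * m.
have f1C : f1%:~R = c%:~R ^+ 2 + 2 * s%:~R :> algC by rewrite rmorphD rmorphM rmorphXn.
have f2C : f2%:~R = (c%:~R ^+ 2 - s%:~R) ^+ 2 + 6 * c%:~R * m%:~R :> algC.
  by rewrite rmorphD rmorphXn rmorphB rmorphXn /= !intrM.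
have TC : T%:~R = c%:~R ^+ 3 - 3 * s%:~R * c%:~R + 9 * m%:~R :> algC.
  have -> : T = c ^+ 3 - 3 * s * c + 9 * m by rewrite -Em; ring.
  by rewrite rmorphD rmorphB rmorphXn /= !intrM.
have sgc (j : int) : sg j%:~R = j%:~R by rewrite rmorph_int.
have sgp x : sg ((x - c%:~R) ^+ 2 / 3) = (sg x - c%:~R) ^+ 2 / 3.
  by rewrite fmorph_div rmorphXn rmorphB /= sgc rmorph_nat.
have Op : ON n t0 t1 t2 p.
  split.
    apply: inNM; last by apply: inNV; apply: inN_quad; exact: (quad_int n0 3).
    have Nc : inN n t0 t1 t2 (t0 - c%:~R).
      apply: inND; first exact: inN_t0.
      by apply: inNN; apply: inN_quad; exact: quad_int.
    by rewrite expr2; exact: inNM.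
  apply: (@Aint_cubic f1 f2 (3 * m ^+ 2)); rewrite f1C f2C rmorphM rmorphXn /=.
  (* With the even powers of [y] gathered on the right, squaring leaves only even powers, hence a
     cubic equation for [p = y^2 / 3]; after division by 27 it reads
     [p (p + c^2 - s)^2 = 3 (m - c p)^2]. Its coefficients are [f1], [f2] and [3 m^2]. *)
  pose y := t0 - c%:~R.
  have Ey : y * (y ^+ 2 + 3 * (c%:~R ^+ 2 - s%:~R)) = 9 * m%:~R - 3 * c%:~R * y ^+ 2.
    apply/eqP; rewrite -subr_eq0; apply/eqP.
    transitivity (t0 ^+ 3 - (3 * s%:~R * t0 + T%:~R)); last by rewrite t03 subrr.
    by rewrite TC /y; ring.
  have Ey2 := congr1 (fun x => x ^+ 2) Ey.
  transitivity (((y * (y ^+ 2 + 3 * (c%:~R ^+ 2 - s%:~R))) ^+ 2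
     - (9 * m%:~R - 3 * c%:~R * y ^+ 2) ^+ 2) / 27); first by rewrite /p -/y; field.
  by rewrite Ey subrr mul0r.
have Ep : p = (t0 - c%:~R) ^+ 2 / 3 by [].
have sp : sg p = (t1 - c%:~R) ^+ 2 / 3 by rewrite Ep sgp sg0.
have ssp : sg (sg p) = (t2 - c%:~R) ^+ 2 / 3 by rewrite sp sgp sg1.
have Tp : Tr sg p = f1%:~R.
  rewrite /Tr ssp sp Ep f1C.
  have -> : (t0 - c%:~R) ^+ 2 / 3 + (t1 - c%:~R) ^+ 2 / 3 + (t2 - c%:~R) ^+ 2 / 3 =
    ((t0 + t1 + t2) ^+ 2 - 2 * (t0 * t1 + t1 * t2 + t2 * t0) - 2 * c%:~R * (t0 + t1 + t2)
       + 3 * c%:~R ^+ 2) / 3 by field.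
  by rewrite sum1 sum2 rmorphM rmorphN; field.
have Tpp : Tr sg (p * sg p) = f2%:~R.
  have sssp : sg (sg (sg p)) = p by rewrite ssp sgp sg2.
  rewrite /Tr (rmorphM sg p) /= (rmorphM sg (sg p)) /= sssp ssp sp Ep f2C.
  pose y1 := t0 + t1 + t2 - 3 * c%:~R.
  pose y2 := t0 * t1 + t1 * t2 + t2 * t0 - 2 * c%:~R * (t0 + t1 + t2) + 3 * c%:~R ^+ 2.
  pose y3 := t0 * t1 * t2 - c%:~R * (t0 * t1 + t1 * t2 + t2 * t0) + c%:~R ^+ 2 * (t0 + t1 + t2)
    - c%:~R ^+ 3.
  transitivity ((y2 ^+ 2 - 2 * y1 * y3) / 9); first by rewrite /y1 /y2 /y3; field.
  by rewrite /y1 /y2 /y3 sum1 sum2 prod3 TC rmorphM rmorphN /=; field.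

(* With [g = k - f2] the two integers are [9 s] and [1 + 3 g], and [9 g^2 + (1 - 3 g)(1 + 3 g) = 1];
   the second relation is [f1^2 - 3 k = 1]. *)
apply: (class_number_dvd3_cubic n0 sum1 sum2 prod3 qV V0 sgw sg0 sg1 sg2 t0R t1c u4 Op Tp Tpp
  (u := s * (k - f2) ^+ 2) (v := 1 - 3 * (k - f2)) (u' := - k) (v' := f1)).
- have -> : f1 ^+ 2 - 3 * f2 = 1 + 3 * (k - f2) by rewrite /f1 Ek; ring.
  have ss : s * s = 1 by case: hs => ->.
  rewrite (_ : s * (k - f2) ^+ 2 * (0 ^+ 2 - 3 * (- 3 * s)) = 9 * (s * s) * (k - f2) ^+ 2); last by ring.
  by rewrite ss; ring.
- by rewrite -expr2 /f1 Ek; ring.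
Qed.

(** * Real quadratic units and powers of the fundamental unit *)

Lemma sqrtC_flip (n : int) : sqrtC (n%:~R : algC) \notin Crat ->
  exists c : {rmorphism algC -> algC}, c (sqrtC n%:~R) = - sqrtC n%:~R.
Proof.
move=> wQ; have [c cw] : exists c : {rmorphism algC -> algC}, c (sqrtC n%:~R) <> sqrtC n%:~R.
  apply: contrapT => h; case/negP: wQ; apply: fixed_by_aut_Crat => c.
  by apply: contrapT => cw; apply: h; exists c.
exists c; have /eqP : c (sqrtC n%:~R) ^+ 2 = sqrtC n%:~R ^+ 2.
  by rewrite -rmorphXn /= sqrtCK rmorph_int.
by rewrite eqf_sqr => /orP[] /eqP.
Qed.

Lemma qunitM (n : int) (x y : algC) : sqrtC (n%:~R : algC) \notin Crat ->
  qunit n x -> qunit n y -> qunit n (x * y).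
Proof.
move=> /sqrtC_flip[c cw].
have mul x' y' : qint n x' -> qint n y' -> qint n (x' * y').
  move=> /quad_Aint[qx Ax] /quad_Aint[qy Ay].
  by apply: (Aint_qint cw); [exact: quadM | rewrite rpredM].
by move=> [? [? ?]] [? [? ?]]; split; [exact: mul | rewrite mulf_neq0 // invfM; split=> //; exact: mul].
Qed.

Lemma qunitV (n : int) (x : algC) : qunit n x -> qunit n x^-1.
Proof. by move=> [? [? ?]]; split=> //; rewrite invr_eq0 invrK. Qed.

Lemma fund_unit_power (n : int) (e u : algC) : sqrtC (n%:~R : algC) \notin Crat ->
  fund_unit n e -> qunit n u -> 1 < u -> exists k : nat, u = e ^+ k.
Proof.
move=> wQ [Ue [e1 min_e]] Uu u1.
have e0 : 0 < e := lt_trans ltr01 e1; have u0 : 0 < u := lt_trans ltr01 u1.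
have ex : exists j, u < e ^+ j.
  have e10 : 0 < e - 1 by rewrite subr_gt0.
  exists (Num.truncn (u / (e - 1))).+1.
  apply: lt_le_trans (bernoulli _ (ltW e1)).
  have : u / (e - 1) < (Num.truncn (u / (e - 1))).+1%:R.
    by apply: real_truncnS_gt; rewrite realE divr_ge0 // ltW.
  by rewrite ltr_pdivrMr // => h; apply: lt_le_trans h _; rewrite lerDr.
have [[|k] ltk min_k] := ex_minnP ex; first by have := lt_trans u1 ltk; rewrite expr0 ltxx.
have ek0 : 0 < e ^+ k by rewrite exprn_gt0.
have lek : e ^+ k <= u.
  rewrite real_leNgt ?gtr0_real //; apply/negP => /min_k; by rewrite ltnn.
exists k; apply/eqP; rewrite eq_sym eq_le lek /= real_leNgt ?gtr0_real //; apply/negP => ltk'.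
have Uv : qunit n (u / e ^+ k).
  apply: qunitM => //; apply: qunitV.
  elim: (k) => [|i IH]; last by rewrite exprS; exact: qunitM.
  have : qunit n (e * e^-1) by apply: qunitM => //; exact: qunitV.
  by rewrite expr0 divff // gt_eqF.
have : e <= u / e ^+ k by apply: min_e => //; rewrite ltr_pdivlMr // mul1r.
by rewrite ler_pdivlMr // -exprS => /(lt_le_trans ltk); rewrite ltxx.
Qed.

Lemma E_s_cube_root (s T : int) : s = 1 \/ s = -1 -> 3 <= T ->
  exists u : algC, 1 < u /\ u ^+ 3 = E_s s T.
Proof.
move=> hs T3; have E1 : 1 < E_s s T.
  rewrite /E_s ltr_pdivlMr // mul1r; apply: ltr_wpDr.
    by rewrite sqrtC_ge0 ler0z; case: hs => ->; nia.
  have : 2%:~R < T%:~R :> algC by rewrite ltr_int; lia.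
  by [].
exists (3.-root (E_s s T)); rewrite rootCK //; split=> //.
have u0 : 0 <= 3.-root (E_s s T) by rewrite rootC_ge0 // ltW // (lt_trans ltr01).
rewrite real_ltNge ?ger0_real //; apply/negP => u1.
by move: E1; rewrite -(rootCK (n := 3) _ (E_s s T)) // le_gtF // exprn_ile1.
Qed.

(** Modulo 7, [j^3 - 3 j] misses exactly 1 and 6, and [j^3 + 3 j] misses exactly 2 and 5; these are
    the values of [18 t], that is [4 t], for the listed residues of [t]. *)
Lemma trace_mod7 (s t j : int) : 18 * t = j ^+ 3 - 3 * s * j ->
  (s = 1 /\ ((t %% 7)%Z = 2 \/ (t %% 7)%Z = 5)) \/
  (s = -1 /\ ((t %% 7)%Z = 3 \/ (t %% 7)%Z = 4)) -> False.
Proof.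
move=> E H.
have [p Ep] : exists p, t = 7 * p + (t %% 7)%Z by exists (t %/ 7)%Z; rewrite mulrC -divz_eq.
have [q [i [Eq i0 i7]]] : exists q i : int, [/\ j = 7 * q + i, 0 <= i & i < 7].
  by exists (j %/ 7)%Z, (j %% 7)%Z; rewrite mulrC -divz_eq modz_ge0 // ltz_pmod.
have : i = 0 \/ i = 1 \/ i = 2 \/ i = 3 \/ i = 4 \/ i = 5 \/ i = 6 by lia.
rewrite !exprS expr0 in E.
by case: H => -[Es []] Et; rewrite Et in Ep; subst s t; subst j;
  case=> [|[|[|[|[|[|]]]]]] Ei; subst i; lia.
Qed.

Theorem theorem7p1 :
  (forall (t0 t s M : int),
     (t0 = 0 \/ t0 = 4 \/ t0 = 5) -> 1 <= t ->
     ((t0 = 4 \/ t0 = 5) -> s = -1) ->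
     (t0 = 0 -> s = -1 \/ s = 1) ->
     sqfree_part ((t0 + 9 * t) ^+ 2 - 4 * s) M ->
     forall eps : algC, fund_unit M eps ->
     ~ (exists k : int, E_s s (t0 + 9 * t) = eps ^ (3 * k)) ->
     exists h : nat, has_class_number (- 3 * M) h /\ (3 %| h)%N)
  /\
  (forall (t M : int), 1 <= t ->
     ((sqfree_part (81 * t ^+ 2 - 1) M /\ ((t %% 7)%Z = 2 \/ (t %% 7)%Z = 5))
      \/ (sqfree_part (81 * t ^+ 2 + 1) M /\ ((t %% 7)%Z = 3 \/ (t %% 7)%Z = 4))) ->
     exists h : nat, has_class_number (- 3 * M) h /\ (3 %| h)%N).
Proof.
split=> [t0 t s M ht0 t1 hs1 hs2 [_ [r [r0 ET]]] eps fe ncube|t M t1 H].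
- set T := t0 + 9 * t in ET ncube; have T3 : 3 <= T by rewrite /T; lia.
  have hs : s = 1 \/ s = -1.
    case: ht0 => [/hs2[]|/hs1]; by [right|left].
  have M0 : 0 < M.
    have : 0 < M * r%:Z ^+ 2 by rewrite -ET; case: hs => ->; nia.
    by rewrite pmulr_lgt0 // exprn_gt0 // ltz_nat.
  have wQ : sqrtC (M%:~R : algC) \notin Crat.
    apply/negP => Qw; apply: (@discr_not_rat_square s T (r%:R * sqrtC M%:~R) hs T3).
      by rewrite rpredM ?rpred_nat.
    by rewrite exprMn sqrtCK ET rmorphM rmorphXn /= mulrC.
  have [u [u1 Eu]] := E_s_cube_root hs T3; have u0 : 0 < u := lt_trans ltr01 u1.
  have nint j : u + s%:~R / u <> j%:~R.
    move=> Ej; apply: ncube.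
    have Uu := cube_root_qunit hs T3 ET (lt0r_neq0 u0) Eu Ej.
    have [k Ek] := fund_unit_power wQ fe Uu u1.
    by exists k%:Z; rewrite -Eu Ek -exprM mulnC -PoszM.
  (* Modulo 9, [c^3 - 3 s c] is 0 for [c = 0], and for [s = -1] it is 4 at [c = 1] and 5 at
     [c = -1]. For [s = 1] and [c] equal to 1 or -1, [c^2 + 2 s] would be 3. *)
  have [c [m [k [Em Ek]]]] : exists c m k : int,
      T - c ^+ 3 + 3 * s * c = 9 * m /\ (c ^+ 2 + 2 * s) ^+ 2 = 1 + 3 * k.
    case: ht0 => [h|[h|h]]; rewrite /T h.
    - by exists 0, t, 1; case: hs => ->; split; ring.
    - by exists 1, t, 0; rewrite hs1 ?h; [split; ring | left].
    - by exists (-1), (t + 1), 0; rewrite hs1 ?h; [split; ring | right].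
  exact: (class_number_dvd3_unit hs T3 M0 ET Em Ek u0 Eu nint).
(* Taking [T = 18 t] gives [T^2 - 4 s = 4 (81 t^2 - s)], whence the factor 2 in [r]; T is divisible
   by 9, so [c = 0] serves. *)
- have [s [r [hs Er Hs]]] : exists s r : int, [/\ s = 1 \/ s = -1,
      (18 * t) ^+ 2 - 4 * s = M * r ^+ 2
    & (s = 1 /\ ((t %% 7)%Z = 2 \/ (t %% 7)%Z = 5)) \/
      (s = -1 /\ ((t %% 7)%Z = 3 \/ (t %% 7)%Z = 4))].
    case: H => -[[_ [r [r0 Er]]] ht].
    + exists 1, (2 * r%:Z); split; [by left | | by left].
      have -> : M * (2 * r%:Z) ^+ 2 = 4 * (M * r%:Z ^+ 2) by ring.
      by rewrite -Er; ring.
    + exists (-1), (2 * r%:Z); split; [by right | | by right].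
      have -> : M * (2 * r%:Z) ^+ 2 = 4 * (M * r%:Z ^+ 2) by ring.
      by rewrite -Er; ring.
  have T3 : 3 <= 18 * t by lia.
  have M0 : 0 < M.
    have : 0 < M * r ^+ 2 by rewrite -Er; case: hs => ->; nia.
    by case: (leP M 0) => // M0; rewrite ltNge mulr_le0_ge0 // sqr_ge0.
  have [u [u1 Eu]] := E_s_cube_root hs T3; have u0 : 0 < u := lt_trans ltr01 u1.
  apply: (@class_number_dvd3_unit s (18 * t) M r 0 (2 * t) 1 u hs T3 M0 Er) => //.
  + by ring.
  + by case: hs => ->.
  + by move=> j Ej; apply: trace_mod7 Hs; exact: (cube_root_trace hs (lt0r_neq0 u0) Eu Ej).
Qed.
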